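(* Let $\rho>0$, let $n\ge 1$ be an integer and let $r>0$ with $r/n<1/2$. Let $X$ be a homogeneous Poisson point process on $\mathbb{R}^2$ with intensity $\rho$, observed on $A_n=[0,n]^2$, and let $K(r)=\pi r^2$. Then $$\mathbb{E}\widehat K_{1,n}(r)-K(r)=r^2\left(-\frac{8r}{3n}+\frac{r^2}{2n^2}\right),$$ $$\mathbb{E}\widehat K_{2,n}(r)-K(r)=r^2\left(-\frac{8r}{3n}+\frac{r^2}{2n^2}\right)-r^2e^{-\rho n^2}\left(\pi-\frac{8r}{3n}+\frac{r^2}{2n^2}\right)\left(1+\rho n^2\right).$$
   Context: Let $S=\{X_1,\dots,X_N\}$ be the (random) finite set of points of $X$ lying in the square $A_n=[0,n]^2$, so that $N$ is Poisson distributed with mean $\rho n^2$. Let $d(\cdot,\cdot)$ be the Euclidean distance and $\mathbf 1\{\cdot\}$ the indicator function. The Ripley statistics are $$\widehat K_{1,n}(r)=\frac{1}{n^2\rho^2}\sum_{X_i\ne X_j\in S}\mathbf 1\{d(X_i,X_j)\le r\},\qquad \widehat K_{2,n}(r)=\frac{n^2}{N(N-1)}\sum_{X_i\ne X_j\in S}\mathbf 1\{d(X_i,X_j)\le r\},$$ where the sums run over ordered pairs of distinct points of $S$, and $\widehat K_{2,n}(r)=0$ by convention when $N\le 1$. *)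

(* Defs.v *)
From HB Require Import structures.
From mathcomp Require Import all_boot all_order all_algebra.
From mathcomp Require Import finmap.
From mathcomp Require Import all_classical all_reals all_analysis.

Set Implicit Arguments.
Unset Strict Implicit.
Unset Printing Implicit Defensive.

Import Order.TTheory GRing.Theory Num.Theory.
Import numFieldNormedType.Exports.

Local Open Scope classical_set_scope.
Local Open Scope ring_scope.

Definition edist (R : realType) (x y : R * R) : R :=
  Num.sqrt ((x.1 - y.1) ^+ 2 + (x.2 - y.2) ^+ 2).

Definition area (R : realType) : set (R * R) -> \bar R :=
  (@lebesgue_measure R \x @lebesgue_measure R)%E.

(* Mutual independence of a finite family; independence of a subfamily is the
   case where the remaining events are A i = setT. *)
Definition independent (d d' : measure_display) (T : measurableType d)
    (T' : measurableType d') (R : realType) (P : probability T R)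
    (m : nat) (Y : 'I_m -> T -> T') : Prop :=
  forall A : 'I_m -> set T', (forall i, measurable (A i)) ->
    P (\bigcap_(i in [set: 'I_m]) (Y i @^-1` A i)) =
    (\prod_(i < m) P (Y i @^-1` A i))%E.

(* Junk value 0 on infinite sets; local finiteness of X excludes them below. *)
Definition card_set (U : choiceType) (A : set U) : nat := #|` fset_set A|%fset.

Definition npoints (Omega : Type) (R : realType) (X : Omega -> set (R * R))
    (B : set (R * R)) (w : Omega) : nat := card_set (X w `&` B).

(* A point process is a random locally finite set of points (so it has no
   multiple points); its measurability is that of all its counting variables. *)
Record is_point_process (d : measure_display) (Omega : measurableType d)
    (R : realType) (X : Omega -> set (R * R)) : Prop := {
  pp_locally_finite : forall (w : Omega) (B : set (R * R)),
    bounded_set B -> finite_set (X w `&` B) ;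
  pp_measurable : forall B : set (R * R), measurable B -> bounded_set B ->
    measurable_fun [set: Omega] (npoints X B)
}.

(* The second argument of poisson_prob is a dummy; for rate 0 it is the Dirac
   mass at 0, as needed for B of area 0. *)
Record is_poisson_process (d : measure_display) (Omega : measurableType d)
    (R : realType) (P : probability Omega R) (rho : R)
    (X : Omega -> set (R * R)) : Prop := {
  poisson_point_process : is_point_process X ;
  poisson_count_law : forall B : set (R * R), measurable B -> bounded_set B ->
    forall U : set nat,
      P (npoints X B @^-1` U) = poisson_prob (rho * fine (area B)) 0 U ;
  poisson_count_independent : forall (m : nat) (B : 'I_m -> set (R * R)),
    (forall i, measurable (B i)) -> (forall i, bounded_set (B i)) ->
    trivIset [set: 'I_m] B ->
    independent P (fun i => npoints X (B i))
}.

Definition square (R : realType) (n : nat) : set (R * R) :=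
  `[0, n%:R] `*` `[0, n%:R].

Arguments square : clear implicits.

Definition observed (Omega : Type) (R : realType) (X : Omega -> set (R * R))
    (n : nat) (w : Omega) : set (R * R) := X w `&` square R n.

Definition close_pairs (R : realType) (S : set (R * R)) (r : R) : R :=
  \sum_(p \in [set p : (R * R) * (R * R) | [/\ S p.1, S p.2 & p.1 <> p.2]])
    (\1_[set q : (R * R) * (R * R) | edist q.1 q.2 <= r] p : R).

Definition ripley1 (Omega : Type) (R : realType) (X : Omega -> set (R * R))
    (rho : R) (n : nat) (r : R) (w : Omega) : R :=
  (n%:R ^+ 2 * rho ^+ 2)^-1 * close_pairs (observed X n w) r.

Definition ripley2 (Omega : Type) (R : realType) (X : Omega -> set (R * R))
    (n : nat) (r : R) (w : Omega) : R :=
  let N := card_set (observed X n w) in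
  if (N <= 1)%N then 0
  else n%:R ^+ 2 / (N%:R * (N%:R - 1)) * close_pairs (observed X n w) r.

Definition ripleyK (R : realType) (r : R) : R := pi * r ^+ 2.

(* Main.v *)
Require Import Defs.
From HB Require Import structures.
From mathcomp Require Import all_boot all_order all_algebra.
From mathcomp Require Import finmap.
From mathcomp Require Import all_classical all_reals all_analysis.
From mathcomp Require Import measurable_realfun ring lra.

(** Write N for the number of points in the square Q = [0, n]^2 and L for its
    mean.  The pairs of distinct points at distance at most r are all N(N-1)
    ordered pairs minus the far ones, and being far (distance > r) is an open
    condition that forces the points apart.  On a grid of mesh 1/(k+1), the
    number of far pairs is therefore approximated from below by a sum of
    products N_C N_C' of counts in disjoint cells; Mecke's identity
    E[Y g(Y)] = lambda E[g(Y+1)] for a Poisson variable Y, applied to each of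
    the two cells, gives E[F(N) N_C N_C'] = rho^2 |C| |C'| E[F(N+2)], and it
    also gives E[F(N) N(N-1)] = L^2 E[F(N+2)].  Dominated convergence on both
    sides yields
      E[F(N) far] = vol(far) / n^4 * E[F(N) N(N-1)],
    used for F constant and for F(N) = n^2 / (N(N-1)).  The volume of the far
    set follows by grouping the coordinates by axis: the square of a distance is
    the sum of the squares of two coordinate differences, and integrating over
    one axis leaves the integral of (n - sqrt(r^2 - t^2))^2 against the law
    2(n - t) dt of |x - y| on Q, computed by t = r sin(theta). *)

Set Implicit Arguments.
Unset Strict Implicit.
Unset Printing Implicit Defensive.

Import Order.TTheory GRing.Theory Num.Theory.
Import numFieldNormedType.Exports.

Local Open Scope classical_set_scope.
Local Open Scope ring_scope.

(** * The volume of the set of far pairs *)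

Section primitives.
Context {R : realType}.
Notation mu := (@lebesgue_measure R).

(** The primitive is the integral from [b]. The gap between [a] and [b] makes [f] continuous at the
    base point too, hence integrable on every segment starting there. *)
Lemma ex_primitive (f : R -> R) (a b : R) : a < b ->
  (forall x, a < x -> {for x, continuous f}) ->
  exists F : R -> R, forall x, b < x -> is_derive x 1 F (f x).
Proof.
move=> ab cf; exists (fun x => \int[mu]_(t in `[b, x]) f t) => x bx.
have bx1 : x < x + 1 by rewrite ltrDl.
have intf : mu.-integrable `[b, x + 1] (EFin \o f).
  apply: continuous_compact_integrable; first exact: segment_compact.
  apply: continuous_in_subspaceT => y; rewrite inE/= in_itv/= => /andP[by_ _].
  exact/cf/(lt_le_trans ab).
have [dF F'] := continuous_FTC1_closed bx1 intf bx (cf _ (lt_trans ab bx)).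
by rewrite -F' derive1E; exact: derivableP.
Qed.

(** A two-sided derivative on the closed interval supplies the one-sided limits at the endpoints
    that [continuous_FTC2] requires; the degenerate case [a = b] is included. *)
Lemma FTC2_is_derive (f F : R -> R) (a b : R) : a <= b ->
  {in `[a, b], forall x : R, is_derive x 1 F (f x)} ->
  {in `[a, b], continuous f} ->
  (\int[mu]_(x in `[a, b]) (f x)%:E = (F b - F a)%:E)%E.
Proof.
rewrite le_eqVlt => /predU1P[<- _ _|ab dF cf].
  by rewrite set_itv1 integral_set1 subrr.
have cF x : x \in `[a, b] -> {for x, continuous F}.
  move=> xab; apply/differentiable_continuous/derivable1_diffP.
  by have [] := dF x xab.
rewrite EFinB; apply: continuous_FTC2 => //.
- by apply: continuous_in_subspaceT => x; rewrite inE/=; exact: cf.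
- split.
  + by move=> x xab; have [] := dF x (subset_itv_oo_cc xab).
  + by apply: cvg_at_right_filter; apply: cF; rewrite in_itv/= lexx ltW.
  + by apply: cvg_at_left_filter; apply: cF; rewrite in_itv/= lexx ltW.
- move=> x xab; rewrite derive1E.
  by have := dF x (subset_itv_oo_cc xab) => -[_ ->].
Qed.

(* With F' = psi and Phi' = F, both sides equal Phi c + Phi (- c) - 2 * Phi 0. *)
Lemma integral_difference (psi : R -> R) (c : R) : 0 <= c -> continuous psi ->
  (\int[mu]_(x in `[0%R, c]) \int[mu]_(y in `[0%R, c]) (psi (x - y)%R)%:E =
   \int[mu]_(t in `[0%R, c]) ((c - t) * (psi t + psi (- t)))%:E)%E.
Proof.
move=> c0 cpsi.
(* All arguments lie in [[- c, c]]. Each primitive lives strictly to the right of its base point, so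
   the two nested ones start at [- c - 2] and [- c - 1]. *)
have [F dF] := @ex_primitive psi (- c - 3) (- c - 2) ltac:(lra) ltac:(by move=> *; exact: cpsi).
have cF x : - c - 2 < x -> {for x, continuous F}.
  move=> xc; apply/differentiable_continuous/derivable1_diffP.
  by have [] := dF x xc.
have [Phi dPhi] := @ex_primitive F (- c - 2) (- c - 1) ltac:(lra) cF.
(* As a function of [y], [psi (x - y)] has the primitive [- F (x - y)]. *)
transitivity (\int[mu]_(x in `[0%R, c]) (F x - F (x - c))%:E)%E.
  apply: eq_integral => x; rewrite inE/= in_itv/= => /andP[x0 xc].
  rewrite (@FTC2_is_derive _ (fun y => - F (x - y)))//.
  - by rewrite subr0 opprK addrC.
  - move=> y; rewrite in_itv/= => /andP[y0 yc].
    have dF' := dF (x - y) ltac:(lra).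
    have dxy : is_derive y 1 (fun y => x - y) (- 1).
      by apply: is_derive_eq; lra.
    have := is_deriveN (@is_derive1_comp _ F (fun y => x - y) _ _ _ dF' dxy).
    by rewrite mulrN1 opprK.
  - move=> y _; apply: (@continuous_comp _ _ _ (fun y => x - y) psi); last exact: cpsi.
    by apply: cvgB; [exact: cvg_cst|exact: cvg_id].
rewrite (@FTC2_is_derive _ (fun x => Phi x - Phi (x - c)))//.
(* [G] comes from integrating by parts: the derivative of [Phi t + Phi (- t)] cancels the term
   [- (F t - F (- t))] left by the factor [c - t]. *)
- pose G t := (c - t) * (F t - F (- t)) + Phi t + Phi (- t).
  rewrite (@FTC2_is_derive _ G)//.
  + by rewrite /G !subrr sub0r mul0r !oppr0 subrr mulr0; congr EFin; ring.
  + move=> t; rewrite in_itv/= => /andP[t0 tc].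
    have d1 := dF t ltac:(lra).
    have d2 := dF (- t) ltac:(lra).
    have d3 := dPhi t ltac:(lra).
    have d4 := dPhi (- t) ltac:(lra).
    have dN : is_derive t 1 (@GRing.opp R) (- 1) by apply: is_derive_eq; lra.
    have d2' := @is_derive1_comp _ F -%R _ _ _ d2 dN.
    have d4' := @is_derive1_comp _ Phi -%R _ _ _ d4 dN.
    have dc : is_derive t 1 (fun y => c - y) (- 1).
      by apply: is_derive_eq; lra.
    have := is_deriveD (is_deriveD (is_deriveM dc (is_deriveB d1 d2')) d3) d4'.
    move=> H; apply: (is_derive_eq H).
    by rewrite /= !mulrN1 /GRing.scale/= !fctE; ring.
  + move=> t _; apply: cvgM.
      by apply: cvgB; [exact: cvg_cst|exact: cvg_id].
    apply: cvgD; first exact: cpsi.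
    by apply: continuous_comp; [exact: opp_continuous|exact: cpsi].
- move=> x; rewrite in_itv/= => /andP[x0 xc].
  have d1 := dPhi x ltac:(lra).
  have d2 := dPhi (x - c) ltac:(lra).
  have dc : is_derive x 1 (fun y => y - c) 1.
    by apply: is_derive_eq; lra.
  have := is_deriveB d1 (@is_derive1_comp _ Phi (fun y => y - c) _ _ _ d2 dc).
  by rewrite mulr1.
- move=> x; rewrite in_itv/= => /andP[x0 xc].
  apply: cvgB; first by apply: cF; lra.
  apply: (@continuous_comp _ _ _ (fun y => y - c) F); last by apply: cF; lra.
  by apply: cvgB; [exact: cvg_id|exact: cvg_cst].
Qed.

End primitives.

(** * Areas of the parts of a square away from its diagonal *)

Section geometry.
Context {R : realType}.
Notation mu := (@lebesgue_measure R).
Local Notation area2 := ((mu \x mu)%E).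

Definition sqr (c : R) : set (R * R) := `[0, c] `*` `[0, c].

Lemma measurable_sqr (c : R) : measurable (sqr c).
Proof. by apply: measurableX; exact: measurable_itv. Qed.

Lemma area_sqr (c : R) : 0 <= c -> area2 (sqr c) = (c ^+ 2)%:E.
Proof.
move=> c0; rewrite /sqr product_measure1E; [|exact: measurable_itv..].
rewrite /= lebesgue_measure_itv/=.
rewrite lte_fin; case: ltP => [_|c0']; first by rewrite -EFinD -EFinM subr0.
by rewrite mul0e (@le_anti _ _ c 0) ?c0 ?c0' // expr0n.
Qed.

Lemma measurable_gt_set d (T : measurableType d) (h : T -> R) (s : R) : measurable_fun setT h ->
  measurable [set q | s < h q].
Proof.
move=> mh; rewrite (_ : [set q | _] = h @^-1` `]s, +oo[); last first.
  by apply/seteqP; split => q/=; rewrite in_itv/= andbT.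
by rewrite -[_ @^-1` _]setTI; exact: mh.
Qed.

Lemma measurable_diff : measurable_fun setT (fun q : R * R => q.1 - q.2).
Proof. by apply: measurable_funB; [exact: measurable_fst|exact: measurable_snd]. Qed.

(** This is a right triangle with both legs [c - s]: its section at [x] is [[0, x - s[] for [x] in
    [[s, c]] and empty elsewhere. *)
Lemma area_above_diagonal (c s : R) : 0 <= s <= c ->
  area2 (sqr c `&` [set q | s < q.1 - q.2]) = ((c - s) ^+ 2 / 2)%:E.
Proof.
move=> /andP[s0 sc]; rewrite /product_measure1.
rewrite (_ : (fun x => _) = (fun x => (x - s)%:E) \_ `[s, c]); last first.
  apply/funext => x /=; rewrite patchE.
  case: ifPn => [|]; rewrite ?inE/= ?notin_setE /= in_itv/=.
    move=> /andP[sx xc].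
    rewrite (_ : xsection _ _ = `[0, x - s[%classic).
      rewrite lebesgue_measure_itv/= lte_fin.
      by case: ltP => h; rewrite ?sube0//; congr EFin; lra.
    apply/seteqP; split => y/=; rewrite /xsection/= ?in_setE/= /sqr/= !in_itv/=.
      by move=> [[_ /andP[y0 yc]] h]; apply/andP; split => //; lra.
    move=> /andP[y0 yx].
    by split; [split; apply/andP; split|]; lra.
  move=> xc; rewrite (_ : xsection _ _ = set0) ?measure0//.
  apply/seteqP; split => y//=; rewrite /xsection/= in_setE/= /sqr/= !in_itv/=.
  move=> [[/andP[x0 xc'] /andP[y0 yc]] h]; apply: xc; apply/andP; split; lra.
rewrite -integral_mkcond (@FTC2_is_derive _ _ (fun x => (x - s) ^+ 2 / 2))//.
- by rewrite subrr expr0n/= mul0r subr0.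
- move=> x _; apply: is_derive_eq; rewrite /GRing.scale/=. lra.
- by move=> x _; apply: cvgB; [exact: cvg_id|exact: cvg_cst].
Qed.

(** The mirror image of the previous triangle, with sections []x + s, c]] for [x] in
    [[0, c - s]]. *)
Lemma area_below_diagonal (c s : R) : 0 <= s <= c ->
  area2 (sqr c `&` [set q | q.1 - q.2 < - s]) = ((c - s) ^+ 2 / 2)%:E.
Proof.
move=> /andP[s0 sc]; rewrite /product_measure1.
rewrite (_ : (fun x => _) = (fun x => (c - s - x)%:E) \_ `[0, c - s]); last first.
  apply/funext => x /=; rewrite patchE.
  case: ifPn => [|]; rewrite ?inE/= ?notin_setE /= in_itv/=.
    move=> /andP[sx xc].
    rewrite (_ : xsection _ _ = `]x + s, c]%classic).
      rewrite lebesgue_measure_itv/= lte_fin.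
      by case: ltP => h; rewrite -?EFinD//; congr EFin; lra.
    apply/seteqP; split => y/=; rewrite /xsection/= ?in_setE/= /sqr/= !in_itv/=.
      by move=> [[_ /andP[y0 yc]] h]; apply/andP; split => //; lra.
    move=> /andP[y0 yx].
    by split; [split; apply/andP; split|]; lra.
  move=> xc; rewrite (_ : xsection _ _ = set0) ?measure0//.
  apply/seteqP; split => y//=; rewrite /xsection/= in_setE/= /sqr/= !in_itv/=.
  move=> [[/andP[x0 xc'] /andP[y0 yc]] h]; apply: xc; apply/andP; split; lra.
rewrite -integral_mkcond.
rewrite (@FTC2_is_derive _ _ (fun x => - (c - s - x) ^+ 2 / 2)); [|lra|..].
- by congr EFin; ring.
- move=> x _; apply: is_derive_eq; rewrite /GRing.scale/=. lra.
- by move=> x _; apply: cvgB; [exact: cvg_cst|exact: cvg_id].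
Qed.

(** For [t >= 0] the set is the union of the two triangles with [s = Num.sqrt t]. For [t < 0] it is
    the whole square, and [Num.sqrt t = 0] keeps the formula valid. *)
Lemma area_off_diagonal (c t : R) : 0 <= c -> t <= c ^+ 2 ->
  area2 (sqr c `&` [set q | t < (q.1 - q.2) ^+ 2]) =
    ((c - Num.sqrt t) ^+ 2)%:E.
Proof.
move=> c0 tc; have [t0|t0] := ltP t 0.
  rewrite (_ : _ `&` _ = sqr c).
    by rewrite area_sqr// ltr0_sqrtr// subr0.
  by apply/setIidPl => q _ /=; rewrite (lt_le_trans t0) ?sqr_ge0.
set s := Num.sqrt t; have s0 : 0 <= s by exact: sqrtr_ge0.
have ts : t = s ^+ 2 by rewrite sqr_sqrtr.
have sc : s <= c by rewrite -(@ler_pXn2r _ 2) ?nnegrE// -ts.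
have -> : sqr c `&` [set q | t < (q.1 - q.2) ^+ 2] =
    (sqr c `&` [set q | s < q.1 - q.2]) `|` (sqr c `&` [set q | q.1 - q.2 < - s]).
  rewrite -setIUr; congr (_ `&` _); apply/seteqP; split => q/=; rewrite ts.
    move=> h; have [|] := ltP s (q.1 - q.2); [by left|move=> h1; right].
    by rewrite ltNge; apply/negP => h2; move: h; nra.
  by move=> [h|h]; nra.
rewrite measureU//=.
- by rewrite area_above_diagonal ?area_below_diagonal ?s0//; congr EFin; lra.
- apply: measurableI; first exact: measurable_sqr.
  by apply: measurable_gt_set; exact: measurable_diff.
- apply: measurableI; first exact: measurable_sqr.
  rewrite (_ : [set q | _] = [set q | s < - (q.1 - q.2)]).
    by apply: measurable_gt_set; apply: measurableT_comp => //; exact: measurable_diff.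
  by apply/seteqP; split => q/=; rewrite ltrNr.
- by apply/seteqP; split => q//= [[_ h1] [_ h2]]; lra.
Qed.
End geometry.

(** * The volume of the far set as a single integral *)

Section volume.
Context {R : realType}.
Notation mu := (@lebesgue_measure R).
Local Notation area2 := ((mu \x mu)%E).

(* The pair of points (x1, x2), (y1, y2) is encoded as ((x1, y1), (x2, y2)). *)
Definition far_set (c r : R) : set ((R * R) * (R * R)) :=
  (sqr c `*` sqr c) `&`
  [set z | r ^+ 2 < (z.1.1 - z.1.2) ^+ 2 + (z.2.1 - z.2.2) ^+ 2].

(** For [0 <= r <= c], the value at [t] is the area of the pairs of second coordinates that make two
    points far when their first coordinates differ by [t]. *)
Lemma continuous_defect (c r : R) :
  continuous (fun t : R => (c - Num.sqrt (r ^+ 2 - t ^+ 2)) ^+ 2).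
Proof.
move=> t; have h : {for t, continuous (fun t : R => c - Num.sqrt (r ^+ 2 - t ^+ 2))}.
  apply: cvgB; first exact: cvg_cst.
  apply: (@continuous_comp _ _ _ (fun t : R => r ^+ 2 - t ^+ 2) (@Num.sqrt R)).
    by apply: cvgB; [exact: cvg_cst|exact: exprn_continuous].
  exact: sqrt_continuous.
exact: (cvgM h h).
Qed.

Lemma integral_sqr (f : R * R -> \bar R) (c : R) :
  measurable_fun setT f -> (forall z, 0 <= f z)%E ->
  (\int[area2]_(p in sqr c) f p =
   \int[mu]_(x in `[0%R, c]) \int[mu]_(y in `[0%R, c]) f (x, y))%E.
Proof.
move=> mf f0; rewrite integral_mkcond fubini_tonelli1//; last 2 first.
- apply/(measurable_restrictT _ _).1; first exact: measurable_sqr.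
  exact: measurable_funTS.
- by move=> z; rewrite patchE; case: ifPn.
rewrite [RHS]integral_mkcond; apply: eq_integral => x _; rewrite /fubini_F/=.
rewrite [RHS]patchE; case: ifPn => [|].
  rewrite in_setE => xc; rewrite [RHS]integral_mkcond; apply: eq_integral => y _.
  rewrite !patchE; congr (if _ then _ else _).
  by apply/idP/idP; rewrite !in_setE; [case|move=> yc; split].
rewrite notin_setE => xc; apply: integral0_eq => y _.
by rewrite patchE ifN// notin_setE => -[].
Qed.

(* Num.sqrt is 0 on negative numbers, so the squared factor is c ^+ 2 when t > r. *)
Lemma volume_far_integral (c r : R) : 0 <= r <= c ->
  ((area2 \x area2) (far_set c r) =
   \int[mu]_(t in `[0%R, c])
     (2 * (c - t) * (c - Num.sqrt (r ^+ 2 - t ^+ 2)) ^+ 2)%:E)%E.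
Proof.
move=> /andP[r0 rc]; have c0 : 0 <= c by lra.
pose psi t := (c - Num.sqrt (r ^+ 2 - t ^+ 2)) ^+ 2.
rewrite {1}/product_measure1.
(* Fixing the pair [p] of first coordinates leaves an off-diagonal set with threshold
   [r ^+ 2 - (p.1 - p.2) ^+ 2], which is at most [c ^+ 2] because [r <= c]. *)
rewrite (_ : (fun x => _) = (fun p => (psi (p.1 - p.2))%:E) \_ (sqr c)); last first.
  apply/funext => p/=; rewrite patchE; case: ifPn => [|].
    rewrite in_setE => pc; rewrite -area_off_diagonal//; last first.
      by rewrite (@le_trans _ _ (r ^+ 2)) ?gerBl ?sqr_ge0// lerXn2r.
    congr (_ _); apply/seteqP; split => q/=; rewrite /xsection/= /far_set/= in_setE/=.
      by move=> [[_ qc] h]; split => //; lra.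
    by move=> [qc h]; split => //; lra.
  rewrite notin_setE => pc; rewrite (_ : xsection _ _ = set0) ?measure0//.
  by apply/seteqP; split => q//=; rewrite /xsection/= in_setE => -[[]].
rewrite -integral_mkcond integral_sqr; last 2 first.
- apply/measurable_EFinP; apply: (@measurableT_comp _ _ _ _ _ _ psi).
    by apply: continuous_measurable_fun; exact: continuous_defect.
  exact: measurable_diff.
- by move=> z; rewrite lee_fin sqr_ge0.
rewrite integral_difference//; last exact: continuous_defect.
(* [psi] is even, whence the factor 2. *)
apply: eq_integral => t _; congr EFin; rewrite /psi sqrrN; ring.
Qed.

End volume.

(** * Evaluation of the integral *)

Section volume_value.
Context {R : realType}.
Notation mu := (@lebesgue_measure R).
Local Notation area2 := ((mu \x mu)%E).

Lemma integral_defect_trig (c r : R) : 0 < r ->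
  (\int[mu]_(t in `[0%R, r])
     (2 * (c - t) * (c - Num.sqrt (r ^+ 2 - t ^+ 2)) ^+ 2)%:E =
   (2 * r * (c ^+ 3 - c ^+ 2 * r * (pi / 2) + 4 / 3 * c * r ^+ 2
     - c ^+ 2 * r / 2 - r ^+ 3 / 4))%:E)%E.
Proof.
move=> r0.
have pi2 : 0 < pi / 2 :> R by rewrite divr_gt0// pi_gt0.
(* The substitution [t = r * sin x], under which the square root becomes [r * cos x], since [cos] is
   nonnegative on [[0, pi / 2]]. *)
pose F (x : R) := r * sin x.
have dF (x : R) : is_derive x 1 F (r * cos x).
  by apply: is_derive_eq; rewrite /GRing.scale/=; ring.
have F'E : F^`()%classic = (fun x => r * cos x).
  by apply/funext => x; rewrite derive1E; have [_ ->] := dF x.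
have cF' : continuous (fun x : R => r * cos x).
  by move=> x; apply: cvgM; [exact: cvg_cst|exact: continuous_cos].
have cF : continuous F.
  by move=> x; apply: cvgM; [exact: cvg_cst|exact: continuous_sin].
have cc : continuous (fun t : R => 2 * (c - t) * (c - Num.sqrt (r ^+ 2 - t ^+ 2)) ^+ 2).
  move=> t; apply: cvgM; last exact: continuous_defect.
  by apply: cvgM; [exact: cvg_cst|apply: cvgB; [exact: cvg_cst|exact: cvg_id]].
have F0 : F 0 = 0 by rewrite /F sin0 mulr0.
have Fpi2 : F (pi / 2) = r by rewrite /F sin_pihalf mulr1.
pose f (t : R) := 2 * (c - t) * (c - Num.sqrt (r ^+ 2 - t ^+ 2)) ^+ 2.
transitivity (\int[mu]_(t in `[F 0%R, F (pi / 2)%R]) (f t)%:E)%E.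
  by rewrite F0 Fpi2.
rewrite (@integration_by_substitution_increasing R F f 0 (pi / 2)) ?(ltW pi2)//; last 6 first.
- move=> x y; rewrite !in_itv/= => /andP[x0 xpi] /andP[y0 ypi] xy.
  by rewrite /F ltr_pM2l// ltr_sin// in_itv/=; apply/andP; split; lra.
- by rewrite F'E => x _; exact: cF'.
- rewrite F'E; apply/cvg_ex; eexists; apply: cvg_at_right_filter; exact: cF'.
- rewrite F'E; apply/cvg_ex; eexists; apply: cvg_at_left_filter; exact: cF'.
- split; last 2 first.
  + by apply: cvg_at_right_filter; exact: cF.
  + by apply: cvg_at_left_filter; exact: cF.
  by move=> x _; have [] := dF x.
- exact: continuous_subspaceT.
pose g (x : R) := 2 * r * ((c - r * sin x) * (c - r * cos x) ^+ 2 * cos x).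
transitivity (\int[mu]_(x in `[0%R, (pi / 2)%R]) (g x)%:E)%E.
  apply: eq_integral => x; rewrite in_setE/= in_itv/= => /andP[x0 xpi].
  rewrite F'E !fctE/= /g /f /F.
  have -> : r ^+ 2 - (r * sin x) ^+ 2 = (r * cos x) ^+ 2.
    by rewrite !exprMn cos2sin2; ring.
  rewrite sqrtr_sqr ger0_norm; first by congr EFin; ring.
  by rewrite mulr_ge0 ?(ltW r0)// cos_ge0_pihalf//; apply/andP; split; lra.
(* A primitive of [g], found by expanding [g] into monomials in [sin x] and [cos x] and integrating
   term by term. *)
pose G (x : R) := 2 * r * (c ^+ 3 * sin x - c ^+ 2 * r * (x + sin x * cos x)
  + c * r ^+ 2 * (sin x - sin x ^+ 3 / 3) - c ^+ 2 * r / 2 * sin x ^+ 2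
  - 2 / 3 * c * r ^+ 2 * cos x ^+ 3 + r ^+ 3 / 4 * cos x ^+ 4).
rewrite (@FTC2_is_derive _ _ G) ?(ltW pi2)//.
- by rewrite /G sin_pihalf cos_pihalf sin0 cos0; congr EFin; field.
- move=> x _; apply: is_derive_eq.
  rewrite /GRing.scale/=.
  have e : cos x ^+ 2 = 1 - sin x ^+ 2 by rewrite cos2sin2.
  (* [field] treats [sin x] and [cos x] as independent, so the derivative of [G] is [g] only up to a
     multiple of [1 - sin x ^+ 2 - cos x ^+ 2], written out here. *)
  transitivity (g x + 2 * r * (c * r ^+ 2 * cos x - c ^+ 2 * r) *
      (1 - sin x ^+ 2 - cos x ^+ 2)); first by rewrite /g; field.
  by rewrite e; ring.
- move=> x _; apply: cvgM; first exact: cvg_cst.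
  have ck : c - r * cos y @[y --> x] --> c - r * cos x.
    by apply: cvgB; [exact: cvg_cst|exact: cF'].
  apply: cvgM; last exact: continuous_cos.
  by apply: cvgM; [apply: cvgB; [exact: cvg_cst|exact: cF]|exact: (cvgM ck ck)].
Qed.

(** The integral is split at [t = r], beyond which the square root vanishes. As [c ^+ 4] is the
    volume of all pairs, the parenthesis is the volume of the close pairs. *)
Lemma volume_far (c r : R) : 0 < r <= c ->
  ((area2 \x area2) (far_set c r) =
   (c ^+ 4 - (pi * c ^+ 2 * r ^+ 2 - 8 / 3 * c * r ^+ 3 + r ^+ 4 / 2))%:E)%E.
Proof.
move=> /andP[r0 rc]; rewrite volume_far_integral; last by rewrite ltW.
pose f t : R := 2 * (c - t) * (c - Num.sqrt (r ^+ 2 - t ^+ 2)) ^+ 2.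
have mf : measurable_fun setT f.
  apply: continuous_measurable_fun => t; apply: cvgM; last exact: continuous_defect.
  by apply: cvgM; [exact: cvg_cst|apply: cvgB; [exact: cvg_cst|exact: cvg_id]].
have -> : `[0, c]%classic = `[0, r] `|` `]r, c].
  by rewrite -itv_bndbnd_setU// bnd_simp ?ltW.
rewrite ge0_integral_setU//=; last 3 first.
- exact/measurable_EFinP/measurable_funTS.
- move=> x []; rewrite /= in_itv/= => /andP[x0 xr]; rewrite lee_fin.
    by rewrite mulr_ge0 ?sqr_ge0//; lra.
  by rewrite mulr_ge0 ?sqr_ge0//; lra.
- apply/disj_setPLR => x /=; rewrite !in_itv/= => /andP[_ xr] /andP[rx _]; lra.
rewrite integral_defect_trig// integral_itv_obnd_cbnd; last first.
  exact/measurable_EFinP/measurable_funTS.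
pose G (x : R) := - c ^+ 2 * (c - x) ^+ 2.
transitivity ((2 * r * (c ^+ 3 - c ^+ 2 * r * (pi / 2) + 4 / 3 * c * r ^+ 2
     - c ^+ 2 * r / 2 - r ^+ 3 / 4))%:E +
  \int[mu]_(t in `[r, c]) (2 * (c - t) * c ^+ 2)%:E)%E.
  congr (_ + _)%E; apply: eq_integral => x; rewrite in_setE/= in_itv/= => /andP[rx xc].
  by rewrite ler0_sqrtr ?subr0// subr_le0 lerXn2r ?nnegrE//; lra.
rewrite (@FTC2_is_derive _ _ G)//.
- by rewrite -EFinD /G; congr EFin; field.
- by move=> x _; apply: is_derive_eq; rewrite /GRing.scale/=; ring.
- move=> x _; apply: cvgM; last exact: cvg_cst.
  by apply: cvgM; [exact: cvg_cst|apply: cvgB; [exact: cvg_cst|exact: cvg_id]].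
Qed.
End volume_value.

(** * Mecke's identity for Poisson variables *)

Section mecke.
Local Open Scope ereal_scope.
Context {R : realType}.

Lemma nneseries_shift0 (a : nat -> \bar R) : (forall k, 0 <= a k) -> a 0%N = 0 ->
  \sum_(k <oo) a k = \sum_(k <oo) a k.+1.
Proof.
move=> a0 a00; apply/cvg_lim => //; rewrite -cvg_shiftS/=.
under eq_fun do rewrite big_nat_recl// a00 add0e.
by apply: is_cvg_nneseries => *; exact: a0.
Qed.

Lemma poisson_prob1 (lambda : R) (k : nat) : (0 < lambda)%R ->
  poisson_prob lambda 0 [set k] = (poisson_pmf lambda k)%:E.
Proof. by move=> l0; rewrite /poisson_prob l0 esum_set1// lee_fin poisson_pmf_ge0. Qed.

(** The mass function satisfies [k * p k = lambda * p (k - 1)], and the term at 0 vanishes. Rate 0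
    is included because a grid cell on the boundary can have area 0; both sides are then 0. *)
Lemma poisson_shift (lambda : R) (z : nat -> \bar R) :
  (0 <= lambda)%R -> (forall k, 0 <= z k) ->
  \sum_(k <oo) k%:R%:E * z k * poisson_prob lambda 0 [set k] =
  lambda%:E * \sum_(k <oo) z k.+1 * poisson_prob lambda 0 [set k].
Proof.
rewrite le_eqVlt => /predU1P[<-|l0] z0.
  rewrite mul0e eseries0// => k _ _; rewrite /poisson_prob ltxx diracE.
  by case: k => [|k]; rewrite ?mul0e// memNset ?mule0.
rewrite nneseries_shift0; last 2 first.
- by move=> k; rewrite !mule_ge0 ?lee_fin// measure_ge0.
- by rewrite !mul0e.
rewrite -nneseriesZl; last by move=> k _; rewrite mule_ge0 ?measure_ge0.
apply: eq_eseriesr => k _; rewrite !poisson_prob1//.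
rewrite [_ * z _]muleC -muleA [in RHS]muleCA; congr (_ * _).
rewrite -!EFinM; congr EFin; rewrite /poisson_pmf l0 exprS factS natrM.
have k1 : k.+1%:R != 0%R :> R by rewrite pnatr_eq0.
have kf : k`!%:R != 0%R :> R by rewrite pnatr_eq0 -lt0n fact_gt0.
by field; rewrite kf addrC -natr1 in k1 *.
Qed.

Context d (Omega : measurableType d) (P : probability Omega R).

Lemma measurable_fiber (Y : Omega -> nat) (k : nat) : measurable_fun setT Y ->
  measurable (Y @^-1` [set k]).
Proof. by move=> mY; rewrite -[_ @^-1` _]setTI; exact: mY. Qed.

Lemma fibers_cover (Y : Omega -> nat) (E : set Omega) :
  E = \bigcup_k (E `&` Y @^-1` [set k]).
Proof.
by apply/seteqP; split => [w Ew|w [k _ []//]]; exists (Y w).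
Qed.

(** The fibers of [Y] form a countable measurable cover, and on each of them the function agrees
    with one [F k]. *)
Lemma measurable_fun_nat_index d' (T' : measurableType d') (Y : Omega -> nat)
    (F : nat -> Omega -> T') : measurable_fun setT Y ->
  (forall k, measurable_fun setT (F k)) ->
  measurable_fun setT (fun w => F (Y w) w).
Proof.
move=> mY mF; rewrite (fibers_cover Y setT); apply/measurable_fun_bigcup.
  by move=> k; apply: measurableI => //; exact: measurable_fiber.
move=> k; apply: (@eq_measurable_fun _ _ _ _ _ (F k)).
  by move=> w; rewrite in_setE => -[_ /= ->].
exact: measurable_funTS.
Qed.

Lemma integral_fibers (Y : Omega -> nat) (E : set Omega) (f : Omega -> \bar R) :
  measurable_fun setT Y -> measurable E -> measurable_fun setT f ->
  (forall w, 0 <= f w) ->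
  \int[P]_(w in E) f w = \sum_(k <oo) \int[P]_(w in E `&` Y @^-1` [set k]) f w.
Proof.
move=> mY mE mf f0; rewrite {1}(fibers_cover Y E) ge0_integral_bigcup//.
- by move=> k; apply: measurableI => //; exact: measurable_fiber.
- exact: measurable_funTS.
- by apply/trivIsetP => i j _ _ ij; apply/seteqP; split => // w [[_ /= ->] [_ /= ji]];
    move: ij; rewrite ji eqxx.
Qed.

(** The factorization hypothesis combines the Poisson law of [Y] with its independence from [E], so
    no conditional probability is needed. *)
Lemma integral_poisson (Y : Omega -> nat) (lambda : R) (E : set Omega)
    (phi : nat -> \bar R) :
  measurable_fun setT Y -> measurable E ->
  (forall k, P (E `&` Y @^-1` [set k]) = P E * poisson_prob lambda 0 [set k]) ->
  (forall k, 0 <= phi k) ->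
  \int[P]_(w in E) phi (Y w) =
    P E * \sum_(k <oo) phi k * poisson_prob lambda 0 [set k].
Proof.
move=> mY mE PE phi0; rewrite (integral_fibers (Y := Y))//; last first.
  exact: (measurable_fun_nat_index (F := fun k _ => phi k)).
have finPE : P E = (fine (P E))%:E by rewrite fineK// fin_num_measure.
rewrite finPE -nneseriesZl; last by move=> k _; rewrite mule_ge0// measure_ge0.
apply: eq_eseriesr => k _; rewrite -finPE.
under eq_integral => w do [rewrite in_setE => -[_ /= ->]].
rewrite integral_cst; first by rewrite /= PE muleCA.
by apply: measurableI => //; exact: measurable_fiber.
Qed.

(** Mecke's identity restricted to an event [E], which below fixes the values of other counts. *)
Lemma mecke_poisson (Y : Omega -> nat) (lambda : R) (E : set Omega)
    (phi : nat -> \bar R) :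
  (0 <= lambda)%R -> measurable_fun setT Y -> measurable E ->
  (forall k, P (E `&` Y @^-1` [set k]) = P E * poisson_prob lambda 0 [set k]) ->
  (forall k, 0 <= phi k) ->
  \int[P]_(w in E) ((Y w)%:R%:E * phi (Y w)) =
    lambda%:E * \int[P]_(w in E) phi (Y w).+1.
Proof.
move=> l0 mY mE PE phi0.
rewrite (integral_poisson (phi := fun k => k%:R%:E * phi k) mY mE PE); last first.
  by move=> k; rewrite mule_ge0.
rewrite (integral_poisson (phi := fun k => phi k.+1) mY mE PE)//.
by rewrite poisson_shift// muleCA.
Qed.

(** Cutting along the values [b] of [Y2] and [e] of [Y3] freezes two arguments of [g]; on each piece
    the identity for [Y1] alone applies. *)
Lemma mecke_poisson3 (Y1 Y2 Y3 : Omega -> nat) (lambda : R)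
    (g : nat -> nat -> nat -> \bar R) :
  (0 <= lambda)%R ->
  measurable_fun setT Y1 -> measurable_fun setT Y2 -> measurable_fun setT Y3 ->
  (forall a b e, P (Y2 @^-1` [set b] `&` Y3 @^-1` [set e] `&` Y1 @^-1` [set a]) =
     P (Y2 @^-1` [set b] `&` Y3 @^-1` [set e]) * poisson_prob lambda 0 [set a]) ->
  (forall a b e, 0 <= g a b e) ->
  \int[P]_w ((Y1 w)%:R%:E * g (Y1 w) (Y2 w) (Y3 w)) =
    lambda%:E * \int[P]_w g (Y1 w).+1 (Y2 w) (Y3 w).
Proof.
move=> l0 m1 m2 m3 ind g0.
have mg (G : nat -> nat -> nat -> \bar R) :
    measurable_fun setT (fun w => G (Y1 w) (Y2 w) (Y3 w)).
  apply: (measurable_fun_nat_index (F := fun k w => G k (Y2 w) (Y3 w))) => // k.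
  apply: (measurable_fun_nat_index (F := fun j w => G k j (Y3 w))) => // j.
  exact: (measurable_fun_nat_index (F := fun i w => G k j i)).
have split3 (G : nat -> nat -> nat -> \bar R) : (forall a b e, 0 <= G a b e) ->
    \int[P]_w G (Y1 w) (Y2 w) (Y3 w) =
    \sum_(b <oo) \sum_(e <oo)
      \int[P]_(w in Y2 @^-1` [set b] `&` Y3 @^-1` [set e]) G (Y1 w) b e.
  move=> G0; rewrite (integral_fibers (Y := Y2))//.
  apply: eq_eseriesr => b _; rewrite setTI (integral_fibers (Y := Y3))//; last first.
    exact: measurable_fiber.
  apply: eq_eseriesr => e _; apply: eq_integral => w; rewrite in_setE.
  by move=> [/= -> ->].
rewrite (split3 (fun a b e => a%:R%:E * g a b e)); last first.
  by move=> a b e; rewrite mule_ge0.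
rewrite (split3 (fun a b e => g a.+1 b e))// -nneseriesZl; last first.
  by move=> b _; apply: nneseries_ge0 => e _ _; exact: integral_ge0.
apply: eq_eseriesr => b _; rewrite -nneseriesZl; last first.
  by move=> e _; exact: integral_ge0.
apply: eq_eseriesr => e _; apply: (mecke_poisson (phi := fun a => g a b e)) => //.
by apply: measurableI; exact: measurable_fiber.
Qed.

End mecke.

(** * Grid approximation *)

Section grid.
Context {R : realType}.
Implicit Types (u v x : R) (k : nat).

Definition grid_index k u : nat := Num.trunc (u * k.+1%:R).

(* Points of cells i and j differ by at least |i - j| - 1 meshes; the
   predecessor of 0 is 0. *)
Definition index_gap (i j : nat) : nat := ((i - j) + (j - i)).-1.

Definition grid_gap k u v : R :=
  (index_gap (grid_index k u) (grid_index k v))%:R / k.+1%:R.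

Lemma index_gapC (i j : nat) : index_gap i j = index_gap j i.
Proof. by rewrite /index_gap addnC. Qed.

Lemma grid_gapC k u v : grid_gap k u v = grid_gap k v u.
Proof. by rewrite /grid_gap index_gapC. Qed.

Lemma grid_gap_ge0 k u v : 0 <= grid_gap k u v.
Proof. by rewrite divr_ge0. Qed.

(** Truncation changes the rescaled difference by less than 1 either way; the predecessor in
    [index_gap] lowers it by one more, which makes the gap an underestimate. *)
Lemma grid_gap_bounds k u v : 0 <= u -> 0 <= v ->
  `|u - v| - 2 / k.+1%:R <= grid_gap k u v <= `|u - v|.
Proof.
have k0 : 0 < k.+1%:R :> R by [].
wlog uv : u v / v <= u => [hw u0 v0|u0 v0].
  have [vu|/ltW vu] := leP v u; first exact: hw.
  by rewrite grid_gapC distrC; exact: hw.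
rewrite ger0_norm ?subr_ge0//.
have /truncn_itv/andP[] : 0 <= u * k.+1%:R by rewrite mulr_ge0.
have /truncn_itv/andP[] : 0 <= v * k.+1%:R by rewrite mulr_ge0.
rewrite -/(grid_index k u) -/(grid_index k v).
have : (grid_index k v <= grid_index k u)%N by apply: le_truncn; rewrite ler_wpM2r.
rewrite /grid_gap /index_gap; set i := grid_index k u; set j := grid_index k v.
move=> ji; rewrite -!natr1.
have -> : (j - i = 0)%N by apply/eqP; rewrite subn_eq0.
rewrite addn0 => h1 h2 h3 h4.
have uv' : 0 <= (u - v) * k.+1%:R by rewrite mulr_ge0// subr_ge0.
rewrite ler_pdivrMr// ler_pdivlMr// mulrBl divfK ?gt_eqF//.
move: uv'; rewrite mulrBl => uv'.
(* Equal indices are treated apart because the predecessor then subtracts nothing. *)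
have [ij|ij] := leqP i j.
  have e : i = j :> nat by apply/eqP; rewrite eqn_leq ij ji.
  by rewrite e subnn/=; move: h3 h4; rewrite e => h3 h4; lra.
rewrite -subn1 !natrB ?subn_gt0//; lra.
Qed.

Lemma grid_gap_cvg u v : 0 <= u -> 0 <= v ->
  grid_gap k u v @[k --> \oo] --> `|u - v|.
Proof.
move=> u0 v0; apply: (@squeeze_cvgr _ _ _ _ (fun k => `|u - v| - 2 / k.+1%:R) (fun=> `|u - v|)).
- by apply: nearW => k; exact: grid_gap_bounds.
- rewrite -[X in _ --> X]subr0; apply: cvgB; first exact: cvg_cst.
  rewrite -(mulr0 2); apply: cvgM; first exact: cvg_cst.
  exact: cvg_harmonic.
- exact: cvg_cst.
Qed.

(** A strict inequality at the limit holds eventually along the sequence. If it fails at the limit,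
    it fails for every [k], since the gaps never exceed the true differences. *)
Lemma grid_far_near (r u1 v1 u2 v2 : R) :
  0 <= u1 -> 0 <= v1 -> 0 <= u2 -> 0 <= v2 ->
  \forall k \near \oo,
    (r ^+ 2 < grid_gap k u1 v1 ^+ 2 + grid_gap k u2 v2 ^+ 2) =
    (r ^+ 2 < (u1 - v1) ^+ 2 + (u2 - v2) ^+ 2).
Proof.
move=> u10 v10 u20 v20.
rewrite -(real_normK (num_real (u1 - v1))) -(real_normK (num_real (u2 - v2))).
have [far|near] := ltP (r ^+ 2) (`|u1 - v1| ^+ 2 + `|u2 - v2| ^+ 2).
  have c1 := grid_gap_cvg u10 v10; have c2 := grid_gap_cvg u20 v20.
  have c : grid_gap k u1 v1 ^+ 2 + grid_gap k u2 v2 ^+ 2 @[k --> \oo] -->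
      `|u1 - v1| ^+ 2 + `|u2 - v2| ^+ 2.
    by apply: cvgD; [exact: (cvgM c1 c1)|exact: (cvgM c2 c2)].
  exact: (cvgr_gt _ c).
apply: nearW => k; apply/negbTE; rewrite -leNgt (le_trans _ near)//.
have /andP[_ h1] := grid_gap_bounds k u10 v10.
have /andP[_ h2] := grid_gap_bounds k u20 v20.
by rewrite lerD// lerXn2r// nnegrE ?grid_gap_ge0.
Qed.

(** [Num.trunc] is 0 on negative numbers, so the index condition alone would leave cell 0
    unbounded. *)
Definition grid_cell (c : R) k i : set R :=
  `[0, c] `&` [set x | grid_index k x = i].

Lemma measurable_grid_cell (c : R) k i : measurable (grid_cell c k i).
Proof.
rewrite /grid_cell (_ : _ `&` _ =
    `[0, c] `&` `[i%:R / k.+1%:R, i.+1%:R / k.+1%:R[).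
  by apply: measurableI; exact: measurable_itv.
apply/seteqP; split => x/=; rewrite !in_itv/= => -[/andP[x0 xc]].
  move=> <-; rewrite x0 xc ler_pdivrMr// ltr_pdivlMr//; split => //.
  by apply: truncn_itv; rewrite mulr_ge0.
rewrite x0 xc ler_pdivrMr// ltr_pdivlMr// => h; split => //; exact: truncn_def.
Qed.

(** The endpoint [n%:R] has index [n * k.+1], hence one more index than there are meshes. *)
Lemma grid_index_lt (n : nat) k x : x \in `[0, n%:R] ->
  (grid_index k x < (n * k.+1).+1)%N.
Proof.
rewrite in_itv/= => /andP[x0 xn]; rewrite ltnS -(ler_nat R).
by rewrite (le_trans (_ : _ <= x * k.+1%:R))// ?truncn_le ?mulr_ge0// natrM ler_wpM2r.
Qed.

End grid.

Lemma bounded_set_sub (R : realType) (A B : set (R * R)) :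
  A `<=` B -> bounded_set B -> bounded_set A.
Proof. by move=> AB [M [Mreal hM]]; exists M; split => // m /hM h x /AB /h. Qed.

Lemma bounded_sqr (R : realType) (c : R) : bounded_set (sqr c).
Proof. by apply: compact_bounded; apply: compact_setX; exact: segment_compact. Qed.

(** * Mecke's identity for counts of a Poisson process *)

Section point_process.
Context (R : realType) d (Omega : measurableType d) (P : probability Omega R).
Context (rho : R) (X : Omega -> set (R * R)).
Context (rho_ge0 : 0 <= rho).
Context (XP : is_poisson_process P rho X).

Let N (B : set (R * R)) := npoints X B.

Lemma measurable_npoints (B : set (R * R)) : measurable B -> bounded_set B ->
  measurable_fun setT (N B).
Proof. exact: (pp_measurable (poisson_point_process XP)). Qed.

Lemma npoints3_indep (B1 B2 B3 : set (R * R)) (U1 U2 U3 : set nat) :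
  measurable B1 -> measurable B2 -> measurable B3 ->
  bounded_set B1 -> bounded_set B2 -> bounded_set B3 ->
  B1 `&` B2 = set0 -> B1 `&` B3 = set0 -> B2 `&` B3 = set0 ->
  P (N B1 @^-1` U1 `&` (N B2 @^-1` U2 `&` N B3 @^-1` U3)) =
  (P (N B1 @^-1` U1) * (P (N B2 @^-1` U2) * P (N B3 @^-1` U3)))%E.
Proof.
move=> m1 m2 m3 b1 b2 b3 d12 d13 d23.
pose B (i : 'I_3) := match val i with 0%N => B1 | 1%N => B2 | _ => B3 end.
pose U (i : 'I_3) := match val i with 0%N => U1 | 1%N => U2 | _ => U3 end.
have mB i : measurable (B i) by rewrite /B; case: (val i) => [|[|]].
have bB i : bounded_set (B i) by rewrite /B; case: (val i) => [|[|]].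
have dB : trivIset [set: 'I_3] B.
  apply/trivIsetP => i j _ _; rewrite -val_eqE /B.
  case: i j => [[|[|[|//]]] hi] [[|[|[|//]]] hj] //= _; by rewrite setIC.
have := poisson_count_independent XP mB bB dB (A := U) (fun=> I).
rewrite !big_ord_recl big_ord0 mule1 /= => <-; congr (P _).
apply/seteqP; split => w /=.
  by move=> [h1 [h2 h3]] [[|[|[|//]]] hi].
by move=> h; split; [|split]; [exact: (h ord0)|exact: (h (lift ord0 ord0))|exact: (h ord_max)].
Qed.

Lemma bounded_set0 : bounded_set (set0 : set (R * R)).
Proof. by apply: bounded_set_sub (bounded_sqr 0). Qed.

(** The case of an empty third set with its count unconstrained. *)
Lemma npoints2_indep (B1 B2 : set (R * R)) (U1 U2 : set nat) :
  measurable B1 -> measurable B2 -> bounded_set B1 -> bounded_set B2 ->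
  B1 `&` B2 = set0 ->
  P (N B1 @^-1` U1 `&` N B2 @^-1` U2) =
  (P (N B1 @^-1` U1) * P (N B2 @^-1` U2))%E.
Proof.
move=> m1 m2 b1 b2 d12.
have := @npoints3_indep B1 B2 set0 U1 U2 setT m1 m2 measurable0 b1 b2
  bounded_set0 d12 (setI0 _) (setI0 _).
by rewrite preimage_setT setIT probability_setT mule1.
Qed.

Lemma poisson_mecke (B1 B2 B3 : set (R * R)) (g : nat -> nat -> nat -> \bar R) :
  measurable B1 -> measurable B2 -> measurable B3 ->
  bounded_set B1 -> bounded_set B2 -> bounded_set B3 ->
  B1 `&` B2 = set0 -> B1 `&` B3 = set0 -> B2 `&` B3 = set0 ->
  (forall a b e, 0 <= g a b e)%E ->
  (\int[P]_w ((N B1 w)%:R%:E * g (N B1 w) (N B2 w) (N B3 w)) =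
   (rho * fine (area B1))%:E * \int[P]_w g (N B1 w).+1 (N B2 w) (N B3 w))%E.
Proof.
move=> m1 m2 m3 b1 b2 b3 d12 d13 d23 g0.
apply: mecke_poisson3 => //; try exact: measurable_npoints.
  by rewrite mulr_ge0// fine_ge0// measure_ge0.
move=> a b e; rewrite [_ `&` N B1 @^-1` _]setIC npoints3_indep// npoints2_indep//.
by rewrite muleC -(poisson_count_law XP m1 b1).
Qed.

(** Mecke's identity is used twice on the same count, first with [(a - 1) * F a], then with
    [F a.+1]; the two other sets are empty. *)
Lemma poisson_mecke2 (B : set (R * R)) (F : nat -> R) :
  measurable B -> bounded_set B -> (forall k, 0 <= F k) ->
  (\int[P]_w ((N B w * (N B w).-1)%:R * F (N B w))%:E =
   ((rho * fine (area B)) ^+ 2)%:E * \int[P]_w (F (N B w).+2)%:E)%E.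
Proof.
move=> mB bB F0.
have m0 : measurable (set0 : set (R * R)) by [].
have mk g := @poisson_mecke B set0 set0 (fun a _ _ => (g a)%:E) mB m0 m0 bB
  bounded_set0 bounded_set0 (setI0 _) (setI0 _) (setI0 _).
rewrite expr2 EFinM -muleA -(mk (fun a => F a.+1)); last by move=> *; rewrite lee_fin.
transitivity (\int[P]_w ((N B w)%:R%:E * ((N B w).-1%:R * F (N B w))%:E))%E.
  by apply: eq_integral => w _; rewrite -EFinM natrM mulrA.
rewrite (mk (fun a => a.-1%:R * F a)); last by move=> *; rewrite lee_fin mulr_ge0.
by congr (_ * _)%E; apply: eq_integral => w _; rewrite -EFinM.
Qed.

(** Counts in all subsets of [Q] become sums over one common list, so relations between them reduce
    to relations between indicators. *)
Lemma npoints_fset (Q B : set (R * R)) w : bounded_set Q -> B `<=` Q ->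
  N B w = (\sum_(x <- fset_set (X w `&` Q)) (x \in B))%N.
Proof.
move=> bQ BQ; have fQ : finite_set (X w `&` Q).
  exact: (pp_locally_finite (poisson_point_process XP)).
have fB : finite_set (X w `&` B).
  by apply: sub_finite_set fQ => x [? /BQ].
transitivity (size [seq x <- fset_set (X w `&` Q) | x \in B]).
  apply/perm_size/uniq_perm; rewrite ?filter_uniq ?fset_uniq// => x.
  rewrite mem_filter !in_fset_set//; apply/idP/andP; rewrite !in_setE.
    by move=> [Xx Bx]; split => //; split => //; exact: BQ.
  by move=> [Bx [Xx _]].
rewrite size_filter -sum1_count big_mkcond; apply: eq_bigr => x _.
by case: (x \in B).
Qed.

(** The count in [Q] is the sum of the counts in [C], [C'] and the remainder [D]. Mecke's identity
    in [C], then in [C'], removes one factor each time and adds one point to [Q]; disjointness keeps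
    the other counts unchanged. *)
Lemma poisson_pair (Q C C' : set (R * R)) (F : nat -> R) :
  measurable Q -> measurable C -> measurable C' -> bounded_set Q ->
  C `<=` Q -> C' `<=` Q -> C `&` C' = set0 -> (forall k, 0 <= F k) ->
  (\int[P]_w (F (N Q w) * ((N C w)%:R * (N C' w)%:R))%:E =
   ((rho * fine (area C)) * (rho * fine (area C')))%:E *
     \int[P]_w (F (N Q w).+2)%:E)%E.
Proof.
move=> mQ mC mC' bQ CQ C'Q CC' F0.
pose D := Q `\` (C `|` C').
have mD : measurable D by apply: measurableD => //; exact: measurableU.
have bC := bounded_set_sub CQ bQ; have bC' := bounded_set_sub C'Q bQ.
have DQ : D `<=` Q by exact: subDsetl.
have bD := bounded_set_sub DQ bQ.
have CD : C `&` D = set0.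
  by apply/seteqP; split => // x [Cx [_ nx]]; apply: nx; left.
have C'D : C' `&` D = set0.
  by apply/seteqP; split => // x [Cx [_ nx]]; apply: nx; right.
have NE w : N Q w = (N C w + N C' w + N D w)%N.
  rewrite !(npoints_fset w bQ)// -!big_split/= big_seq [RHS]big_seq.
  apply: eq_bigr => x; rewrite in_fset_set; last first.
    exact: (pp_locally_finite (poisson_point_process XP)).
  rewrite in_setI => /andP[_ xQ]; rewrite xQ in_setD in_setU xQ/=.
  case: (boolP (x \in C)) => xC; case: (boolP (x \in C')) => xC' //.
  by have : (C `&` C') x; [split; exact: set_mem|rewrite CC'].
have mk1 := @poisson_mecke C C' D (fun a b e => (b%:R * F (a + b + e)%N)%:E)
  mC mC' mD bC bC' bD CC' CD C'D.
have mk2 := @poisson_mecke C' C D (fun a b e => (F (b + a + e).+1)%:E)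
  mC' mC mD bC' bC bD _ C'D CD.
rewrite EFinM -muleA.
transitivity ((rho * fine (area C))%:E * \int[P]_w ((N C' w)%:R%:E *
    (F (N C w + N C' w + N D w).+1)%:E))%E.
  rewrite -[X in (_ = _ * X)%E](_ : \int[P]_w
      ((N C' w)%:R * F ((N C w).+1 + N C' w + N D w)%N)%:E = _)%E.
    rewrite -mk1; last by move=> *; rewrite lee_fin mulr_ge0.
    by apply: eq_integral => w _; rewrite NE -EFinM; congr EFin; ring.
  by apply: eq_integral => w _; rewrite -EFinM !addSn.
rewrite mk2; first last.
- by move=> *; rewrite lee_fin.
- by rewrite setIC.
congr (_ * (_ * _))%E; apply: eq_integral => w _; congr (F _)%:E.
by rewrite NE addnS addSn.
Qed.

End point_process.

(** * Area as a sigma-finite measure *)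

Section plane_measure.
Context {R : realType}.
Notation mu := (@lebesgue_measure R).
Local Notation T := (measurableTypeR R).
(* mu \x mu alone carries no canonical sigma-finite structure, which is needed to
   form its product with itself. *)
Definition plane_measure : set (T * T) -> \bar R := (mu \x mu)%E.
HB.instance Definition _ := Measure.on plane_measure.
(** The exhaustion of the line is nondecreasing, so the indices found for two coordinates can both
    be raised to their maximum. *)
Lemma plane_measure_sigma_finite : sigma_finite setT plane_measure.
Proof.
have /sigma_finiteP[F [TF ndF Foo]] := sigma_finiteT mu.
exists (fun n => F n `*` F n).
  rewrite -setXTT TF predeqE => -[x y]; split.
    move=> [/= [n _ Fnx] [k _ Fky]]; exists (maxn n k) => //; split.
    - by move: x Fnx; exact/subsetPset/ndF/leq_maxl.
    - by move: y Fky; exact/subsetPset/ndF/leq_maxr.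
  by move=> [n _ []/= ? ?]; split; exists n.
move=> k; have [mF Fk] := Foo k.
split; first exact: measurableX.
by rewrite /plane_measure product_measure1E// lte_mul_pinfty// ge0_fin_numE.
Qed.
HB.instance Definition _ := Measure_isSigmaFinite.Build _ _ _ plane_measure
  plane_measure_sigma_finite.

Lemma plane_measureX (A B : set (R * R)) : measurable A -> measurable B ->
  (plane_measure \x plane_measure)%E (A `*` B) =
  (plane_measure A * plane_measure B)%E.
Proof. by move=> mA mB; exact: (@product_measure1E _ _ _ _ R plane_measure plane_measure). Qed.

End plane_measure.

(** * Grid cells of the square and pairs of far cells *)

Section grid_cells.
Context {R : realType}.
Context (n k : nat) (r : R).
Notation mu := (@lebesgue_measure R).
Local Notation area2 := ((mu \x mu)%E).
Local Notation J := ('I_(n * k.+1).+1 * 'I_(n * k.+1).+1)%type.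

Definition grid_square (j : J) : set (R * R) :=
  grid_cell n%:R k j.1 `*` grid_cell n%:R k j.2.

Definition cells_far (j j' : J) : bool :=
  r ^+ 2 < ((index_gap j.1 j'.1)%:R / k.+1%:R) ^+ 2 +
           ((index_gap j.2 j'.2)%:R / k.+1%:R) ^+ 2.

Definition grid_far (x y : R * R) : bool :=
  r ^+ 2 < grid_gap k x.1 y.1 ^+ 2 + grid_gap k x.2 y.2 ^+ 2.

Lemma measurable_grid_square (j : J) : measurable (grid_square j).
Proof. by apply: measurableX; exact: measurable_grid_cell. Qed.

Lemma grid_square_sub (j : J) : grid_square j `<=` sqr n%:R.
Proof. by move=> x [[x1 _] [x2 _]]; split. Qed.

Lemma grid_square_disjoint (j j' : J) : j != j' ->
  grid_square j `&` grid_square j' = set0.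
Proof.
case: j j' => j1 j2 [j1' j2'] jj'; apply/seteqP; split => // x.
move=> [[[_ /= a1] [_ /= a2]] [[_ /= b1] [_ /= b2]]].
by case/eqP: jj'; congr pair; apply: val_inj; rewrite /= -?a1 -?a2.
Qed.

(** A cell has gap 0 to itself. Far cells are thus disjoint, as [poisson_pair] requires. *)
Lemma cells_far_neq (j j' : J) : cells_far j j' -> j != j'.
Proof.
apply: contraTneq => <-; rewrite /cells_far /index_gap !subnn/= !mul0r expr0n/=.
by rewrite addr0 -leNgt sqr_ge0.
Qed.

(** On the square both indices are in range by [grid_index_lt], so [inord] does not fall back on its
    default there. *)
Definition square_index (x : R * R) : J :=
  (inord (grid_index k x.1), inord (grid_index k x.2)).

Lemma grid_square_index (x : R * R) (j : J) : sqr n%:R x ->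
  (x \in grid_square j) = (j == square_index x).
Proof.
move=> [x1 x2]; have i1 := grid_index_lt k x1; have i2 := grid_index_lt k x2.
apply/idP/eqP => [|->]; rewrite in_setE.
  case: j => j1 j2 [[_ /= a1] [_ /= a2]].
  by congr pair; apply: val_inj; rewrite /= inordK.
by split; split => //=; rewrite inordK.
Qed.

Lemma sum_grid_square (x : R * R) (f : J -> R) : sqr n%:R x ->
  \sum_j f j * (x \in grid_square j)%:R = f (square_index x).
Proof.
move=> Qx; rewrite (bigD1 (square_index x))//= big1 ?addr0.
  by rewrite grid_square_index// eqxx mulr1.
by move=> j jx; rewrite grid_square_index// (negbTE jx) mulr0.
Qed.

Lemma grid_far_index (x y : R * R) : sqr n%:R x -> sqr n%:R y ->
  grid_far x y = cells_far (square_index x) (square_index y).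
Proof.
move=> [x1 x2] [y1 y2]; rewrite /grid_far /cells_far /square_index/=.
by rewrite !inordK//; exact: grid_index_lt.
Qed.

(** Each point lies in exactly one cell. The expansion separates [x] from [y], so that summing over
    points yields products of cell counts. *)
Lemma grid_far_sum (x y : R * R) : sqr n%:R x -> sqr n%:R y ->
  (grid_far x y)%:R = \sum_j \sum_j'
    (cells_far j j')%:R * ((x \in grid_square j)%:R * (y \in grid_square j')%:R) :> R.
Proof.
move=> Qx Qy; rewrite grid_far_index//.
rewrite -(sum_grid_square (fun j => (cells_far j (square_index y))%:R) Qx).
apply: eq_bigr => j _; rewrite -(sum_grid_square (fun j' => (cells_far j j')%:R) Qy).
by rewrite mulr_suml; apply: eq_bigr => j' _; rewrite mulrA mulrAC.
Qed.

Lemma mu_grid_cell i : mu (grid_cell n%:R k i) = (fine (mu (grid_cell n%:R k i)))%:E.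
Proof.
rewrite fineK// ge0_fin_numE ?measure_ge0//.
apply: (@le_lt_trans _ _ (mu `[0, n%:R])).
  apply: le_measure; rewrite ?inE//=; [exact: measurable_grid_cell|].
  by move=> x [].
by rewrite lebesgue_measure_itv/=; case: ifP => // _; rewrite -EFinD ltry.
Qed.

Definition square_area (j : J) : R :=
  fine (mu (grid_cell n%:R k j.1)) * fine (mu (grid_cell n%:R k j.2)).

Lemma area_grid_cells i i' :
  area2 (grid_cell n%:R k i `*` grid_cell n%:R k i') =
  (fine (mu (grid_cell n%:R k i)) * fine (mu (grid_cell n%:R k i')))%:E.
Proof.
by rewrite product_measure1E 1?EFinM -?mu_grid_cell//; exact: measurable_grid_cell.
Qed.

Lemma area_grid_square (j : J) : fine (area (grid_square j)) = square_area j.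
Proof. by rewrite /area area_grid_cells.
Qed.

Definition grid_far_set : set ((R * R) * (R * R)) :=
  (sqr n%:R `*` sqr n%:R) `&`
  [set z | grid_far (z.1.1, z.2.1) (z.1.2, z.2.2)].

(** The product of the cells [j] and [j'], with coordinates grouped by axis as in [far_set]. *)
Definition square_pair (j j' : J) : set ((R * R) * (R * R)) :=
  (grid_cell n%:R k j.1 `*` grid_cell n%:R k j'.1) `*`
  (grid_cell n%:R k j.2 `*` grid_cell n%:R k j'.2).

Lemma measurable_square_pair (j j' : J) : measurable (square_pair j j').
Proof. by apply: measurableX; apply: measurableX; exact: measurable_grid_cell. Qed.

Lemma measurable_indic_square_pair (j j' : J) :
  measurable_fun setT (\1_(square_pair j j') : _ -> R).
Proof. by apply: measurable_indic; exact: measurable_square_pair. Qed.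

Lemma volume_square_pair (j j' : J) :
  ((plane_measure \x plane_measure) (square_pair j j') = (square_area j * square_area j')%:E)%E.
Proof.
transitivity (area2 (grid_cell n%:R k j.1 `*` grid_cell n%:R k j'.1) *
              area2 (grid_cell n%:R k j.2 `*` grid_cell n%:R k j'.2))%E.
  by apply: plane_measureX; apply: measurableX; exact: measurable_grid_cell.
by rewrite !area_grid_cells -EFinM /square_area; congr EFin; ring.
Qed.

Lemma indic_grid_far_set z : \1_grid_far_set z = \sum_j \sum_j'
   (cells_far j j')%:R * \1_(square_pair j j') z :> R.
Proof.
pose x : R * R := (z.1.1, z.2.1); pose y : R * R := (z.1.2, z.2.2).
have indE j j' : \1_(square_pair j j') z =
    (x \in grid_square j)%:R * (y \in grid_square j')%:R :> R.
  rewrite indicE -natrM mulnb; congr (nat_of_bool _)%:R.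
  apply/idP/andP; rewrite !in_setE.
    by move=> [[a b] [c e]]; split; split.
  by move=> [[a c] [b e]]; split; split.
have [Qz|Qz] := pselect ((sqr n%:R `*` sqr n%:R) z).
  have Qx : sqr n%:R x by case: Qz => -[? ?] [? ?]; split.
  have Qy : sqr n%:R y by case: Qz => -[? ?] [? ?]; split.
  under eq_bigr do under eq_bigr do rewrite indE.
  rewrite -grid_far_sum// indicE; congr (nat_of_bool _)%:R.
  by apply/idP/idP; rewrite in_setE; [case|split].
rewrite indicE memNset; last by case.
rewrite big1// => j _; rewrite big1// => j' _; rewrite indE.
case: (boolP (x \in _)) => [/set_mem/grid_square_sub[q1 q2]|]; last by rewrite mul0r mulr0.
case: (boolP (y \in _)) => [/set_mem/grid_square_sub[q3 q4]|]; last by rewrite !mulr0.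
by case: Qz; split; split.
Qed.

(** Up to the factor [rho ^+ 2], the double sum is the coefficient that [poisson_pair] yields when
    summed over all far pairs of cells. *)
Lemma volume_grid_far_set :
  (\int[plane_measure \x plane_measure]_z (\1_grid_far_set z)%:E =
   (\sum_j \sum_j' (cells_far j j')%:R * (square_area j * square_area j'))%:E)%E.
Proof.
under eq_integral do rewrite indic_grid_far_set -sumEFin.
rewrite ge0_integral_sum//; last 2 first.
- move=> j; apply/measurable_EFinP/measurable_sum => j'.
  by apply: measurable_funM => //; exact: measurable_indic_square_pair.
- by move=> j z _; rewrite lee_fin; apply: sumr_ge0 => j' _; rewrite mulr_ge0.
rewrite -sumEFin; apply: eq_bigr => j _.
under eq_integral do rewrite -sumEFin.
rewrite ge0_integral_sum//; last first.
  move=> j'; apply/measurable_EFinP.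
  by apply: measurable_funM => //; exact: measurable_indic_square_pair.
rewrite -sumEFin; apply: eq_bigr => j' _.
under eq_integral do rewrite EFinM.
rewrite ge0_integralZl//; last first.
  apply/measurable_EFinP; exact: measurable_indic_square_pair.
rewrite integral_indic ?setIT//; last exact: measurable_square_pair.
by rewrite /= volume_square_pair -EFinM.
Qed.

End grid_cells.

(** * Convergence of the grid volumes to the volume of the far set *)

Section volume_limit.
Context {R : realType}.
Context (n : nat) (r : R).
Local Notation vol := (plane_measure \x plane_measure)%E.

Lemma measurable_far_set (c : R) : measurable (far_set c r).
Proof.
have mh : measurable_fun [set: (R * R) * (R * R)]
    (fun z => (z.1.1 - z.1.2) ^+ 2 + (z.2.1 - z.2.2) ^+ 2).
  have md := @measurable_diff R.
  apply: measurable_funD; apply: measurable_funX.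
    by apply: (measurableT_comp md); exact: measurable_fst.
  by apply: (measurableT_comp md); exact: measurable_snd.
have mfar := measurable_gt_set (r ^+ 2) mh.
by apply: measurableI => //; apply: measurableX; exact: measurable_sqr.
Qed.

Lemma measurable_grid_far_set k : measurable (grid_far_set n k r).
Proof.
have mI : measurable_fun setT (\1_(grid_far_set n k r) : _ -> R).
  rewrite (_ : \1_ _ = fun z => \sum_(j : 'I_(n * k.+1).+1 * 'I_(n * k.+1).+1)
      \sum_(j' : 'I_(n * k.+1).+1 * 'I_(n * k.+1).+1)
        (cells_far r j j')%:R * \1_(square_pair j j') z :> R); last first.
    by apply/funext => z; exact: indic_grid_far_set.
  apply: measurable_sum => j; apply: measurable_sum => j'.
  by apply: measurable_funM => //; exact: measurable_indic_square_pair.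
exact: ((measurable_indicP R _).2 mI).
Qed.

(** Dominated convergence: by [grid_far_near] the indicators are eventually constant at each point,
    and the indicator of the pairs in the square dominates them. *)
Lemma volume_grid_cvg : 0 < r <= n%:R ->
  (\int[vol]_z (\1_(grid_far_set n k r) z)%:E)%E @[k --> \oo] -->
  vol (far_set n%:R r).
Proof.
move=> rn.
pose D : set ((R * R) * (R * R)) := sqr n%:R `*` sqr n%:R.
have mD : measurable D by apply: measurableX; exact: measurable_sqr.
have mfar : measurable (far_set n%:R r).
  exact: measurable_far_set.
rewrite -[far_set _ _]setIT -integral_indic//.
have volD : (vol D < +oo)%E.
  rewrite plane_measureX; [|exact: measurable_sqr..].
  by rewrite /plane_measure area_sqr// -EFinM ltry.
have iD : (\int[vol]_z (\1_D z)%:E = vol D)%E.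
  by rewrite -[in RHS](setIT D) -integral_indic.
have [] := @dominated_convergence _ _ R vol setT measurableT
  (fun k z => (\1_(grid_far_set n k r) z)%:E) (fun z => (\1_(far_set n%:R r) z)%:E)
  (fun z => (\1_D z)%:E).
- move=> k; apply/measurable_EFinP; apply: measurable_indic.
  exact: measurable_grid_far_set.
- exact/measurable_EFinP/measurable_indic.
- apply: aeW => z _; apply: cvg_near_cst.
  have [Dz|Dz] := pselect (D z); last first.
    apply: nearW => k; rewrite !indicE !memNset//; by case.
  have [[/andP[a1 _] /andP[a2 _]] [/andP[a3 _] /andP[a4 _]]] := Dz.
  apply: filterS (grid_far_near r a1 a2 a3 a4) => k e; congr EFin.
  rewrite !indicE; congr (nat_of_bool _)%:R; apply/idP/idP; rewrite !in_setE.
    by move=> [_ h]; split => //; rewrite /= -e.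
  by move=> [_ h]; split => //; rewrite /= /grid_far e.
- apply/integrableP; split; first exact/measurable_EFinP/measurable_indic.
  under eq_integral do rewrite /= ger0_norm//.
  by rewrite iD.
- apply: aeW => z k _; rewrite gee0_abs// lee_fin !indicE ler_nat.
  case: (boolP (z \in D)) => [_|/negP zD]; first exact: leq_b1.
  by rewrite memNset// => -[Dz _]; apply: zD; rewrite in_setE.
- by [].
Qed.
End volume_limit.

(** * Counting pairs of points *)

Section pair_sums.
Context {R : realType}.

(** In a duplicate-free list each [x] excludes exactly one [y], namely itself. *)
Lemma sum_distinct_pairs (T : eqType) (s : seq T) : uniq s ->
  \sum_(x <- s) \sum_(y <- s) (x != y)%:R = (size s * (size s).-1)%:R :> R.
Proof.
move=> us; transitivity (\sum_(x <- s) (size s).-1%:R : R).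
  rewrite big_seq [RHS]big_seq; apply: eq_bigr => x xs.
  rewrite -natr_sum; congr (_ %:R).
  have := count_predC (pred1 x) s; rewrite count_uniq_mem// xs => <- /=.
  rewrite -sum1_count [RHS]big_mkcond/=; apply: eq_bigr => y _.
  by rewrite eq_sym; case: (_ == _).
by rewrite big_const_seq count_predT iter_addr_0 -[LHS]mulr_natl natrM.
Qed.

Definition far (r : R) (x y : R * R) : bool :=
  r ^+ 2 < (x.1 - y.1) ^+ 2 + (x.2 - y.2) ^+ 2.

Lemma edist_le_far (r : R) (x y : R * R) : 0 <= r ->
  (Defs.edist x y <= r) = ~~ far r x y.
Proof.
move=> r0; rewrite /far -leNgt /Defs.edist.
have d0 := addr_ge0 (sqr_ge0 (x.1 - y.1)) (sqr_ge0 (x.2 - y.2)).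
rewrite -[in RHS](sqr_sqrtr d0).
by rewrite ler_pXn2r// nnegrE// sqrtr_ge0.
Qed.

Lemma far_neq (r : R) (x y : R * R) : far r x y -> x != y.
Proof.
apply: contraTneq => <-; rewrite /far !subrr expr0n/= addr0 -leNgt.
exact: sqr_ge0.
Qed.

Lemma grid_far_neq k (r : R) (x y : R * R) : grid_far k r x y -> x != y.
Proof.
apply: contraTneq => <-; rewrite /grid_far /grid_gap /index_gap !subnn/=.
by rewrite !mul0r expr0n/= addr0 -leNgt sqr_ge0.
Qed.

(** Far points are automatically distinct, so close and far are complementary among the ordered
    pairs of distinct points. *)
Lemma close_pairsE (S : set (R * R)) (r : R) : finite_set S -> 0 <= r ->
  close_pairs S r = (size (fset_set S) * (size (fset_set S)).-1)%:R -
    \sum_(x <- fset_set S) \sum_(y <- fset_set S) (far r x y)%:R.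
Proof.
move=> fS r0; rewrite -sum_distinct_pairs ?fset_uniq// -sumrB.
transitivity (\sum_(p \in S `*` S) (((p.1 != p.2)%:R - (far r p.1 p.2)%:R) : R)).
  rewrite /close_pairs.
  have -> : [set p | [/\ S p.1, S p.2 & p.1 <> p.2]] =
      (S `*` S) `&` [set p | p.1 <> p.2].
    by apply/seteqP; split => p /=; [move=> []|move=> [[]]]; split.
  rewrite fsbig_mkcondr; apply: eq_fsbigr => p _.
  case: ifPn => [|]; rewrite ?in_setE ?notin_setE/= => pp.
    rewrite (introN eqP pp)/= indicE.
    rewrite (_ : (p \in _) = ~~ far r p.1 p.2); first by case: far; rewrite ?subrr ?subr0.
    by rewrite -edist_le_far//; apply/idP/idP; rewrite in_setE.
  have /eqP -> : p.1 == p.2 by apply/negPn/negP => /eqP.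
  rewrite eqxx/= (_ : far _ _ _ = false) ?subrr//.
  by apply/negP => /far_neq; rewrite eqxx.
rewrite -(pair_fsbig _ (fun x y => (x != y)%:R - (far r x y)%:R))//.
rewrite fsbig_finite//=; apply: eq_bigr => x _.
by rewrite fsbig_finite//= sumrB.
Qed.

End pair_sums.

(** * Weighted expectation of the number of far pairs on the grid *)

Section expected_far_pairs.
Context (R : realType) d (Omega : measurableType d) (P : probability Omega R).
Context (rho r : R) (n : nat) (X : Omega -> set (R * R)).
Context (rho_ge0 : 0 <= rho).
Context (XP : is_poisson_process P rho X).
Local Notation Q := (sqr (n%:R : R)).
Local Notation S w := (fset_set (X w `&` Q)).
Local Notation N := (npoints X Q).
Local Notation vol := (plane_measure \x plane_measure)%E.
Context (F : nat -> R).
Context (F_ge0 : forall k, 0 <= F k).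

Let finS w : finite_set (X w `&` Q).
Proof. by apply: (pp_locally_finite (poisson_point_process XP)); exact: bounded_sqr. Qed.

Let mQ : measurable Q. Proof. exact: measurable_sqr. Qed.
Let bQ : bounded_set Q. Proof. exact: bounded_sqr. Qed.

Let inQ w x : x \in S w -> Q x.
Proof. by rewrite in_fset_set// in_setE => -[]. Qed.

Lemma measurable_comp_npoints (B : set (R * R)) (f : nat -> R) :
  measurable B -> bounded_set B -> measurable_fun setT (fun w => f (npoints X B w)).
Proof.
move=> mB bB; apply: (measurable_fun_nat_index (F := fun k _ => f k)) => //.
exact: (measurable_npoints XP).
Qed.

Definition grid_far_pairs k w : R :=
  \sum_(x <- S w) \sum_(y <- S w) (grid_far k r x y)%:R.

Definition far_pairs w : R := \sum_(x <- S w) \sum_(y <- S w) (far r x y)%:R.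

(** [grid_far_sum] is inserted for every pair of points, and the sums over cells are moved
    outside. *)
Lemma grid_far_pairs_cells k w : grid_far_pairs k w =
  \sum_(j : 'I_(n * k.+1).+1 * 'I_(n * k.+1).+1)
  \sum_(j' : 'I_(n * k.+1).+1 * 'I_(n * k.+1).+1)
    (cells_far r j j')%:R *
      ((npoints X (grid_square j) w)%:R * (npoints X (grid_square j') w)%:R).
Proof.
have countE j : (npoints X (grid_square j) w)%:R =
    \sum_(x <- S w) (x \in grid_square (n := n) (k := k) j)%:R :> R.
  by rewrite (npoints_fset XP w bQ (grid_square_sub (j := j))) natr_sum.
rewrite /grid_far_pairs big_seq.
under eq_bigr => x xS.
  rewrite big_seq; under eq_bigr => y yS do rewrite (@grid_far_sum R n k r _ _ (inQ xS) (inQ yS)).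
  rewrite -big_seq; over.
rewrite -big_seq /=.
under [RHS]eq_bigr do under eq_bigr do rewrite !countE mulr_suml mulr_sumr.
under eq_bigr do rewrite exchange_big/=.
rewrite exchange_big/=; apply: eq_bigr => j _.
under eq_bigr do rewrite exchange_big/=.
rewrite exchange_big/=; apply: eq_bigr => j' _.
by apply: eq_bigr => x _; rewrite !mulr_sumr.
Qed.

Lemma expectation_grid_far_pairs k :
  (\int[P]_w (F (N w) * grid_far_pairs k w)%:E =
   ((rho ^+ 2)%:E * \int[vol]_z (\1_(grid_far_set n k r) z)%:E) *
     \int[P]_w (F (N w).+2)%:E)%E.
Proof.
pose term (j j' : 'I_(n * k.+1).+1 * 'I_(n * k.+1).+1) w : R :=
  (cells_far r j j')%:R * (F (N w) *
   ((npoints X (grid_square j) w)%:R * (npoints X (grid_square j') w)%:R)).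
have termE w : F (N w) * grid_far_pairs k w = \sum_j \sum_j' term j j' w.
  rewrite grid_far_pairs_cells mulr_sumr; apply: eq_bigr => j _.
  by rewrite mulr_sumr; apply: eq_bigr => j' _; rewrite mulrCA.
have term0 j j' w : 0 <= term j j' w by rewrite !mulr_ge0.
have bsq j : bounded_set (grid_square (R := R) (n := n) (k := k) j).
  exact: bounded_set_sub (grid_square_sub (j := j)) bQ.
have mterm j j' : measurable_fun setT (term j j').
  apply: measurable_funM => //; apply: measurable_funM.
    exact: measurable_comp_npoints.
  apply: measurable_funM.
    by apply: (measurable_comp_npoints (fun m => m%:R)); [exact: measurable_grid_square|].
  by apply: (measurable_comp_npoints (fun m => m%:R)); [exact: measurable_grid_square|].
under eq_integral do rewrite termE -sumEFin.
rewrite ge0_integral_sum//; last 2 first.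
- by move=> j; apply/measurable_EFinP; apply: measurable_sum => j'; exact: mterm.
- by move=> j w _; rewrite lee_fin; apply: sumr_ge0 => j' _; exact: term0.
rewrite volume_grid_far_set.
have a0 j : 0 <= square_area (R := R) (n := n) (k := k) j.
  by rewrite mulr_ge0// fine_ge0// measure_ge0.
rewrite -EFinM mulr_sumr -sumEFin ge0_sume_distrl; last first.
  move=> j _; rewrite lee_fin mulr_ge0 ?sqr_ge0//; apply: sumr_ge0 => j' _.
  by apply: mulr_ge0 => //; apply: mulr_ge0; exact: a0.
apply: eq_bigr => j _.
under eq_integral do rewrite -sumEFin.
rewrite ge0_integral_sum//; last 2 first.
- by move=> j'; apply/measurable_EFinP; exact: mterm.
- by move=> j' w _; rewrite lee_fin; exact: term0.
rewrite mulr_sumr -sumEFin ge0_sume_distrl; last first.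
  move=> j' _; rewrite lee_fin mulr_ge0 ?sqr_ge0//.
  by apply: mulr_ge0 => //; apply: mulr_ge0; exact: a0.
apply: eq_bigr => j' _; rewrite /term.
(* Cells that are not far, which may coincide, have coefficient 0; only disjoint cells remain for
   [poisson_pair]. *)
case: (boolP (cells_far r j j')) => [cf|_]; last first.
  by under eq_integral do rewrite mul0r; rewrite integral0 mul0r mulr0 mul0e.
under eq_integral do rewrite mul1r.
have dis := grid_square_disjoint (R := R) (cells_far_neq cf).
rewrite (poisson_pair rho_ge0 XP mQ (measurable_grid_square j)
  (measurable_grid_square j') bQ (grid_square_sub (j := j))
  (grid_square_sub (j := j')) dis F_ge0).
by rewrite !area_grid_square [in RHS]mul1r; congr (_%:E * _)%E; ring.
Qed.

Lemma measurable_grid_far_pairs k : measurable_fun setT (grid_far_pairs k).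
Proof.
have bsq j : bounded_set (grid_square (R := R) (n := n) (k := k) j).
  exact: bounded_set_sub (grid_square_sub (j := j)) bQ.
have -> : grid_far_pairs k = fun w =>
  \sum_(j : 'I_(n * k.+1).+1 * 'I_(n * k.+1).+1)
  \sum_(j' : 'I_(n * k.+1).+1 * 'I_(n * k.+1).+1)
    (cells_far r j j')%:R *
      ((npoints X (grid_square j) w)%:R * (npoints X (grid_square j') w)%:R).
  by apply/funext => w; exact: grid_far_pairs_cells.
apply: measurable_sum => j; apply: measurable_sum => j'.
apply: measurable_funM => //; apply: measurable_funM.
  by apply: (measurable_comp_npoints (fun m => m%:R)); [exact: measurable_grid_square|].
by apply: (measurable_comp_npoints (fun m => m%:R)); [exact: measurable_grid_square|].
Qed.

Lemma grid_far_pairs_ge0 k w : 0 <= grid_far_pairs k w.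
Proof. by apply: sumr_ge0 => x _; apply: sumr_ge0. Qed.

(** This bound, uniform in [k], serves as the dominating function. *)
Lemma grid_far_pairs_le k w : grid_far_pairs k w <= (N w * (N w).-1)%:R.
Proof.
rewrite -[leRHS](sum_distinct_pairs (fset_uniq (S w))).
apply: ler_sum => x _; apply: ler_sum => y _; rewrite ler_nat.
by case: (boolP (grid_far k r x y)) => // /grid_far_neq ->.
Qed.

Lemma grid_far_pairs_cvg w : grid_far_pairs k w @[k --> \oo] --> far_pairs w.
Proof.
apply: cvg_near_cst; rewrite /grid_far_pairs /far_pairs.
have h x y : x \in S w -> y \in S w ->
    \forall k \near \oo, grid_far k r x y = far r x y.
  move=> /inQ[/andP[x1 _] /andP[x2 _]] /inQ[/andP[y1 _] /andP[y2 _]].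
  exact: grid_far_near.
(* There are finitely many pairs, so one threshold for [k] serves them all; induction on the list of
   pairs. *)
have h2 : \forall k \near \oo, forall xy, xy \in [seq (x, y) | x <- S w, y <- S w] ->
    grid_far k r xy.1 xy.2 = far r xy.1 xy.2.
  have : forall xy, xy \in [seq (x, y) | x <- S w, y <- S w] ->
      \forall k \near \oo, grid_far k r xy.1 xy.2 = far r xy.1 xy.2.
    by move=> _ /allpairsP[[x y] [xS yS ->]]; exact: h.
  elim: [seq (x, y) | x <- S w, y <- S w] => [_|p s ih hs].
    by apply: nearW.
  have := ih (fun q qs => hs q (mem_behead (s := p :: s) qs)).
  apply: filterS2 (hs p (mem_head _ _)) => k h1 h3 q.
  by rewrite inE => /orP[/eqP ->//|]; exact: h3.
apply: filterS h2 => k hk.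
rewrite big_seq [RHS]big_seq; apply: eq_bigr => x xS.
rewrite big_seq [RHS]big_seq; apply: eq_bigr => y yS.
by rewrite (hk (x, y))//; apply/allpairsP; exists (x, y).
Qed.

End expected_far_pairs.

(** * Weighted expectation of the number of close pairs *)

Section expected_close_pairs.
Context (R : realType) d (Omega : measurableType d) (P : probability Omega R).
Context (rho r : R) (n : nat) (X : Omega -> set (R * R)).
Context (rho_gt0 : 0 < rho).
Context (XP : is_poisson_process P rho X).
Context (rn : 0 < r <= n%:R).
Local Notation Q := (sqr (n%:R : R)).
Local Notation N := (npoints X Q).
Local Notation vol := (plane_measure \x plane_measure)%E.
Context (F : nat -> R).
Context (F_ge0 : forall k, 0 <= F k).
Context (m : R).
Context (Fm : (\int[P]_w ((N w * (N w).-1)%:R * F (N w))%:E = m%:E)%E).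

Let mQ : measurable Q. Proof. exact: measurable_sqr. Qed.
Let bQ : bounded_set Q. Proof. exact: bounded_sqr. Qed.

(** [poisson_mecke2] solved for the shifted expectation, the mean [rho * n%:R ^+ 2] being
    positive. *)
Lemma integral_shift2 :
  (\int[P]_w (F (N w).+2)%:E = (m / (rho * n%:R ^+ 2) ^+ 2)%:E)%E.
Proof.
have n0 : 0 < n%:R :> R by case/andP: rn; apply: lt_le_trans.
have L0 : 0 < (rho * n%:R ^+ 2) ^+ 2 by rewrite exprn_gt0// mulr_gt0// exprn_gt0.
have := Fm; rewrite (poisson_mecke2 (ltW rho_gt0) XP mQ bQ F_ge0).
rewrite /area area_sqr ?ltW//= => e.
by rewrite mulrC EFinM -e muleA -EFinM mulVf ?mul1e ?gt_eqF.
Qed.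

Lemma integrable_pairs :
  P.-integrable setT (fun w => ((N w * (N w).-1)%:R * F (N w))%:E).
Proof.
apply/integrableP; split.
  apply/measurable_EFinP.
  exact: (measurable_comp_npoints XP (fun k => (k * k.-1)%:R * F k)).
under eq_integral do rewrite gee0_abs ?lee_fin ?mulr_ge0//.
by rewrite Fm ltry.
Qed.

Let grid_term k w : R := F (N w) * grid_far_pairs r n X k w.

Let measurable_grid_term k : measurable_fun setT (grid_term k).
Proof.
apply: measurable_funM; first exact: (measurable_comp_npoints XP).
exact: (measurable_grid_far_pairs r n XP).
Qed.

Let grid_term_cvg w : grid_term k w @[k --> \oo] --> F (N w) * far_pairs r n X w.
Proof.
have h := @grid_far_pairs_cvg _ _ _ _ _ r n _ XP w.
exact: (cvgM (cvg_cst (F (N w))) h).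
Qed.

(** A pointwise limit of the grid terms, which are functions of finitely many counts. *)
Lemma measurable_far_pairs :
  measurable_fun setT (fun w => F (N w) * far_pairs r n X w).
Proof. by apply: (measurable_fun_cvg measurable_grid_term) => w _; exact: grid_term_cvg. Qed.

(** Dominated convergence in the expectation and in the volume gives two limits of one sequence, so
    the expectation is [m] times the far volume divided by [n%:R ^+ 4]. *)
Lemma expectation_far_pairs :
  P.-integrable setT (fun w => (F (N w) * far_pairs r n X w)%:E) /\
  (\int[P]_w (F (N w) * far_pairs r n X w)%:E =
   (m * (1 - (pi * n%:R ^+ 2 * r ^+ 2 - 8 / 3 * n%:R * r ^+ 3 + r ^+ 4 / 2)
             / n%:R ^+ 4))%:E)%E.
Proof.
have n0 : 0 < n%:R :> R by case/andP: rn; apply: lt_le_trans.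
have [] := @dominated_convergence _ _ R P setT measurableT
  (fun k w => (grid_term k w)%:E) (fun w => (F (N w) * far_pairs r n X w)%:E)
  (fun w => ((N w * (N w).-1)%:R * F (N w))%:E).
- by move=> k; apply/measurable_EFinP; exact: measurable_grid_term.
- by apply/measurable_EFinP; exact: measurable_far_pairs.
- by apply: aeW => w _; apply: cvg_EFin; [exact: nearW|exact: grid_term_cvg].
- exact: integrable_pairs.
- apply: aeW => w k _; rewrite gee0_abs; last first.
    by rewrite lee_fin mulr_ge0// grid_far_pairs_ge0.
  by rewrite lee_fin /grid_term mulrC ler_wpM2r// grid_far_pairs_le.
move=> intf _ lim; split => //.
have limE k : (\int[P]_w (grid_term k w)%:E =
    (rho ^+ 2)%:E * (\int[vol]_z (\1_(grid_far_set n k r) z)%:E) *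
    (m / (rho * n%:R ^+ 2) ^+ 2)%:E)%E.
  by rewrite (expectation_grid_far_pairs r n (ltW rho_gt0) XP F_ge0) integral_shift2.
have vol_far : vol (far_set n%:R r) = (n%:R ^+ 4 - (pi * n%:R ^+ 2 * r ^+ 2
    - 8 / 3 * n%:R * r ^+ 3 + r ^+ 4 / 2))%:E by exact: volume_far.
have lim2 : (\int[P]_w (grid_term k w)%:E)%E @[k --> \oo] -->
    ((rho ^+ 2)%:E * vol (far_set n%:R r) * (m / (rho * n%:R ^+ 2) ^+ 2)%:E)%E.
  under eq_fun do rewrite limE.
  by apply: cvgeZr => //; apply: cvgeZl => //; exact: volume_grid_cvg.
rewrite -(cvg_lim _ lim)// (cvg_lim _ lim2)// vol_far -!EFinM; congr EFin.
by field; rewrite !gt_eqF.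
Qed.

(** All distinct pairs minus the far ones; both parts are integrable, so their expectations
    subtract. *)
Lemma expectation_close_pairs :
  (\int[P]_w (F (N w) * close_pairs (X w `&` Q) r)%:E =
   (m * ((pi * n%:R ^+ 2 * r ^+ 2 - 8 / 3 * n%:R * r ^+ 3 + r ^+ 4 / 2)
             / n%:R ^+ 4))%:E)%E.
Proof.
have [intf expf] := expectation_far_pairs.
have r0 : 0 <= r by case/andP: rn => /ltW.
transitivity (\int[P]_w (((N w * (N w).-1)%:R * F (N w))%:E -
    (F (N w) * far_pairs r n X w)%:E))%E.
  apply: eq_integral => w _; rewrite -EFinB close_pairsE//; last first.
    exact: (pp_locally_finite (poisson_point_process XP)).
  by rewrite mulrBr; congr (_ - _)%:E; rewrite mulrC.
rewrite integralB_EFin//; last exact: integrable_pairs.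
by rewrite Fm expf -EFinB; congr EFin; ring.
Qed.

End expected_close_pairs.

(** * The probability that a Poisson variable is at least two *)

Section poisson_two.
Context (R : realType) d (Omega : measurableType d) (P : probability Omega R).

Lemma poisson_ge2 (Y : Omega -> nat) (lambda : R) : 0 < lambda ->
  measurable_fun setT Y ->
  (forall U, P (Y @^-1` U) = poisson_prob lambda 0 U) ->
  P [set w | (1 < Y w)%N] = (1 - expR (- lambda) * (1 + lambda))%:E.
Proof.
move=> l0 mY law.
have -> : [set w | (1 < Y w)%N] = ~` (Y @^-1` [set 0%N] `|` Y @^-1` [set 1%N]).
  apply/seteqP; split => w /=; first by move=> h [] e; move: h; rewrite e.
  by case: (Y w) => [h|[h|//]]; exfalso; apply: h; [left|right].
have m0 := measurable_fiber 0 mY; have m1 := measurable_fiber 1 mY.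
rewrite probability_setC; last exact: measurableU.
rewrite measureU//; last first.
  by apply/seteqP; split => // w [/= ->].
rewrite /= !law !poisson_prob1// /poisson_pmf l0 -!EFinD; congr EFin.
by rewrite expr0 expr1 fact0 factS fact0 !invr1 !mulr1; ring.
Qed.

End poisson_two.

(** * The biases of the two Ripley statistics *)

Theorem proposition1 (R : realType) (d : measure_display)
  (Omega : measurableType d) (P : probability Omega R)
  (rho : R) (n : nat) (r : R) (X : Omega -> set (R * R))
  (rho_gt0 : 0 < rho) (n_ge1 : (1 <= n)%N)
  (r_gt0 : 0 < r) (r_small : r / n%:R < 1 / 2)
  (X_poisson : is_poisson_process P rho X) :
  ('E_P[ripley1 X rho n r] - (ripleyK r)%:E =
    (r ^+ 2 * (- (8 * r) / (3 * n%:R) + r ^+ 2 / (2 * n%:R ^+ 2)))%:E)%E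
  /\
  ('E_P[ripley2 X n r] - (ripleyK r)%:E =
    (r ^+ 2 * (- (8 * r) / (3 * n%:R) + r ^+ 2 / (2 * n%:R ^+ 2))
     - r ^+ 2 * expR (- (rho * n%:R ^+ 2))
       * (pi - (8 * r) / (3 * n%:R) + r ^+ 2 / (2 * n%:R ^+ 2))
       * (1 + rho * n%:R ^+ 2))%:E)%E.
Proof.
have n0 : 0 < n%:R :> R by rewrite ltr0n.
have rn : 0 < r <= n%:R.
  by rewrite r_gt0/=; move: r_small; rewrite ltr_pdivrMr//; lra.
have n0' := gt_eqF n0; have rho0' := gt_eqF rho_gt0.
have mQ : measurable (sqr (n%:R : R)) by exact: measurable_sqr.
have bQ : bounded_set (sqr (n%:R : R)) by exact: bounded_sqr.
have areaQ : fine (area (sqr (n%:R : R))) = n%:R ^+ 2.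
  by rewrite /area area_sqr// ltW.
pose L := rho * n%:R ^+ 2.
have L0 : 0 < L by rewrite mulr_gt0// exprn_gt0.
have mN := measurable_npoints X_poisson mQ bQ.
split.
(* For the first statistic the weight is constant, and the expectation of all weighted pairs is
   [L ^+ 2 * c = n%:R ^+ 2]. *)
- pose c := (n%:R ^+ 2 * rho ^+ 2)^-1 : R.
  have c0 : 0 <= c by rewrite invr_ge0 mulr_ge0// exprn_ge0// ltW.
  have mom := poisson_mecke2 (F := fun=> c) (ltW rho_gt0) X_poisson mQ bQ (fun=> c0).
  rewrite integral_cst//= probability_setT mule1 areaQ -EFinM in mom.
  rewrite unlock (expectation_close_pairs rho_gt0 X_poisson rn (F := fun=> c) (fun=> c0) mom).
  rewrite /ripleyK -EFinB; congr EFin; rewrite /c; field.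
  by rewrite n0' rho0'.
- pose F (k : nat) : R := if (k <= 1)%N then 0 else n%:R ^+ 2 / (k%:R * (k%:R - 1)).
  have F0 k : 0 <= F k.
    rewrite /F; case: leqP => // k1; rewrite divr_ge0 ?exprn_ge0// mulr_ge0//.
    by rewrite subr_ge0 ler1n ltnW.
  (* The weight cancels [N * (N - 1)] when [N >= 2] and is 0 otherwise, which leaves [n%:R ^+ 2]
     times the probability of at least two points. The complementary probability is the source of
     the exponential term in the bias. *)
  have mom : (\int[P]_w ((npoints X (sqr (n%:R : R)) w *
      (npoints X (sqr (n%:R : R)) w).-1)%:R * F (npoints X (sqr (n%:R : R)) w))%:E =
      (n%:R ^+ 2 * (1 - expR (- L) * (1 + L)))%:E)%E.
    pose G2 := [set w | (1 < npoints X (sqr (n%:R : R)) w)%N].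
    have mG2 : measurable G2 by rewrite -[G2]setTI; exact: (mN measurableT [set k | (1 < k)%N]).
    transitivity (\int[P]_w ((n%:R ^+ 2)%:E * (\1_G2 w)%:E))%E.
      apply: eq_integral => w _; rewrite -EFinM; congr EFin; rewrite indicE /F.
      case: leqP => h.
        by rewrite memNset ?mulr0// /G2/= ltnNge h.
      rewrite mem_set//= mulr1; move: h; case: (npoints _ _ w) => // k h.
      rewrite natrM/= -natr1 addrK mulrC divfK// mulf_neq0 ?pnatr_eq0 ?natr1//.
      by rewrite -lt0n.
    rewrite ge0_integralZl//; last exact/measurable_EFinP/measurable_indic.
    rewrite integral_indic// setIT [RHS]EFinM; congr (_ * _)%E.
    apply: poisson_ge2 => // U.
    by rewrite (poisson_count_law X_poisson mQ bQ) areaQ.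
  (* For at most one point, the conventional value 0 of [ripley2] agrees with the weight 0. *)
  rewrite unlock; transitivity (\int[P]_w (F (npoints X (sqr (n%:R : R)) w) *
      close_pairs (X w `&` sqr n%:R) r)%:E - (ripleyK r)%:E)%E.
    congr (_ - _)%E; apply: eq_integral => w _; congr EFin.
    rewrite /ripley2 /F -/(npoints X (square R n) w).
    by case: leqP => //; rewrite mul0r.
  rewrite (expectation_close_pairs rho_gt0 X_poisson rn F0 mom).
  rewrite /ripleyK -EFinB; congr EFin; rewrite /L; field.
  by rewrite n0'.
Qed.
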